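(* MGCBS is a complete solver of the MG-MAPF problem: for every MG-MAPF instance that has a solution, MGCBS terminates and returns a solution.
   Context: MG-MAPF problem. An instance consists of a finite undirected graph $G=(V,E)$ with unit-length edges, agents $A=\{a_1,\dots,a_k\}$, and for each agent $a_i$ a start vertex $s_i\in V$ and goal vertices $g_i=\{g_i^1,\dots,g_i^{n_i}\}\subseteq V$, $n_i\ge 1$. Time is discrete ($0,1,2,\dots$). At each time step an agent either waits at its current vertex or moves to an adjacent vertex. A path for $a_i$ is a finite sequence of vertices starting at $s_i$ at time $0$, each step being a wait or a move along an edge, which visits every goal of $a_i$ at least once, in arbitrary order, and ends at one of the goals of $a_i$; after the end of its path the agent stays forever at the last vertex at no additional cost. The cost of a path is its number of time steps. Two agents collide if they are at the same vertex at the same time step (vertex conflict; this includes times after an agent has finished) or move along the same edge during the same time step (edge conflict). A solution is a collection of pairwise collision-free paths, one per agent. Its sum of costs (SOC) is the sum of the costs of the paths. Constraints and safe intervals. A vertex constraint $(a,t,v)$ forbids agent $a$ from being at $v$ at time $t$ (also after finishing). An edge constraint $(a,t,u,v)$ forbids $a$ from moving from $u$ to $v$ between times $t$ and $t+1$. Fix an agent and a finite set of constraints on it. A TS state is a pair $(t,v)$ (time, vertex); it is safe if it is not forbidden by a vertex constraint. A TIS state $([t_0,t_1],v)$, with $t_1\le+\infty$, is the set of TS states $(t,v)$ with $t\in[t_0,t_1]$; it is safe if all of them are safe. A safe interval (SI) is a safe TIS state whose time interval is maximal. A goal safe interval (GSI) is an SI at a goal vertex of the agent. For a TIS state $q$,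 $q.v$ denotes its vertex. TIS Tree of a seed GSI. Its nodes are safe TIS states with a cost and possibly a parent. Initially there is one node for each SI at each vertex; the seed GSI has cost $0$, all others cost $+\infty$; all nodes are put in a set $U$. Repeatedly remove from $U$ a node $n$ of minimum cost, with TIS state $([t_0,t_1],v)$. For each $v'$ with $(v',v)\in E$ or $v'=v$, let $B$ be the set of maximal time intervals consisting of times $t\ge 0$ such that $(t,v')$ is safe, $t+1\in[t_0,t_1]$, and the transition from $v'$ to $v$ between $t$ and $t+1$ is not forbidden by an edge constraint. For every node $n'$ at $v'$ with cost greater than $\mathrm{cost}(n)+1$ and every interval of $B$: if the time interval of $n'$ is contained in it, set the parent of $n'$ to $n$ and its cost to $\mathrm{cost}(n)+1$; if it is only partly covered, split $n'$ (also in $U$) into nodes according to the coverage and update in this way only the fully covered part. Stop when $U$ is empty. A query $(t,s)$ finds the node whose TIS state contains $(t,s)$; the node's cost is the returned length ($+\infty$ if there is no such node), and the returned path follows the vertices of the nodes along parent pointers up to the seed node. The TIS Forest of an agent consists of the TIS Trees of all its GSIs. Low-level solver (one agent with start vertex $s$, under its constraints). It is an A* search over states $(L,p)$, where $L$ is the set of visited goals and $p$ is the current SI. The initial state is $(\emptyset,p_0)$ with $p_0$ the earliest SI at $s$ and $g$-value $0$. From a state $(L,p)$ with $g$-value $g$ there is a transition to $(L\cup\{q.v\},q)$ for every GSI $q$ with $q.v\notin L$, except that if $q.v$ is the only unvisited goal, only the latest GSI at $q.v$ is allowed. Its cost is the length returned by the TIS Tree of $q$ for the query $(g,p.v)$ (transitions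 of infinite cost are not used). The heuristic value $h$ is the cost of a minimum spanning tree of $p.v$ and all unvisited goals with respect to graph distances in $G$. A state of minimum $f=g+h$ in the open set is moved to the closed set and expanded; states in the closed set are not updated, states in the open set keep the smaller $g$. When a state with all goals visited is removed from the open set, the GSI visiting order is read off by backtracking, and the path is built by concatenating the TIS Tree paths to the successive GSIs of this order. If the open set becomes empty, no path is returned. MGCBS (high-level solver). It maintains a set OPEN of constraint-tree nodes, each with a constraint set, one path per agent, and the SOC of these paths. The root has no constraints and its paths are computed by the low-level solver. Repeatedly remove a node $N$ of minimum SOC from OPEN. If its paths have no collision, return them. Otherwise take the earliest collision; for each of the two agents $a$ involved, form a child node by adding the constraint forbidding $a$'s part in the collision (a vertex constraint $(a,t,v)$ for a vertex conflict at $v$ at time $t$; an edge constraint $(a,t,u,v)$ for an edge conflict in which $a$ moves from $u$ to $v$ between $t$ and $t+1$), rebuild the TIS Forest of $a$, recompute $a$'s path by the low-level solver, and, if a path is returned, insert the child in OPEN. If OPEN becomes empty, no solution is returned. *)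

(* Defs.v *)
From mathcomp Require Import all_boot.

Set Implicit Arguments.
Unset Strict Implicit.
Unset Printing Implicit Defensive.

(** In [option nat], [None] stands for +oo. *)

Definition ext_le (x y : option nat) : bool :=
  match x, y with
  | _, None => true
  | None, Some _ => false
  | Some m, Some n => m <= n
  end.

Definition ext_lt (x y : option nat) : bool := ~~ ext_le y x.

Definition ext_add (x y : option nat) : option nat :=
  match x, y with
  | Some m, Some n => Some (m + n)
  | _, _ => None
  end.

Definition ext_min (x y : option nat) : option nat := if ext_le x y then x else y.

(** [(t0, t1)] is the set of times [t] with [t0 <= t <= t1]. *)
Definition itv : Type := (nat * option nat)%type.

Definition in_itv (J : itv) (t : nat) : bool := (J.1 <= t) && ext_le (Some t) J.2.

Definition is_maximal_itv (P : pred nat) (J : itv) : Prop :=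
  [/\ exists t, in_itv J t,
      forall t, in_itv J t -> P t
    & forall J' : itv, (forall t, in_itv J t -> in_itv J' t) ->
        (forall t, in_itv J' t -> P t) -> J' = J].

(** The maximal intervals of [P], in increasing order, when [P] is constant on
    the times [t >= M]; see [maximal_itvsP] and [maximal_itvs_sorted]. *)
Definition maximal_itvs (P : pred nat) (M : nat) : seq itv :=
  [seq (t0, if all P (iota t0 (M.+1 - t0)) then None
            else Some (t0 + find (predC P) (iota t0 (M.+1 - t0))).-1)
     | t0 <- iota 0 M.+1 & P t0 && ((t0 == 0) || ~~ P t0.-1)].

Lemma maximal_itvsP (P : pred nat) (M : nat) (J : itv) :
  (forall t, M <= t -> P t = P M) ->
  (J \in maximal_itvs P M) <-> is_maximal_itv P J.
Proof.
move=> cP; split.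
  case/mapP=> t0; rewrite mem_filter mem_iota add0n ltnS leq0n /=.
  case/andP=> /andP[Pt0 bt0] le0M ->.
  have lowP (J' : itv) t : in_itv J' t0 -> in_itv J' t ->
      (forall u, in_itv J' u -> P u) -> t0 <= t.
    move=> /andP[lo hi] /andP[lot hit] PJ'; rewrite leqNgt; apply/negP=> lt_t.
    case/orP: bt0 => [/eqP t00|/negP]; first by rewrite t00 in lt_t.
    apply; apply: PJ'; rewrite /in_itv.
    have -> /= : J'.1 <= t0.-1.
      by apply: leq_trans lot _; case: (t0) lt_t.
    by case: J'.2 hi => //= h; apply: leq_trans (leq_pred _).
  case: ifPn => [/allP allP|nall].
    have allt t : t0 <= t -> P t.
      move=> le_t; case: (leqP t M) => [le_tM|/ltnW /cP ->].
        by apply: allP; rewrite mem_iota le_t subnKC ?ltnS // leqW.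
      by apply: allP; rewrite mem_iota le0M subnKC ?ltnSn // leqW.
    split.
    - by exists t0; rewrite /in_itv /= leqnn.
    - by move=> t /andP[/allt].
    move=> [lo hi] sub PJ'; rewrite /=.
    have loE : lo = t0.
      have /andP[/= lo_t0 _] := sub t0 (introT andP (conj (leqnn t0) isT)).
      apply/eqP; rewrite eqn_leq lo_t0 /=.
      apply: (lowP (lo, hi)) => //; first by apply: sub; rewrite /in_itv /= leqnn.
      rewrite /in_itv leqnn /=; case: hi sub {PJ'} => //= h sub.
      have /andP[/= _ h0] := sub t0 (introT andP (conj (leqnn t0) isT)).
      exact: leq_trans lo_t0 h0.
    case: hi sub {PJ'} => [h|] sub; last by rewrite loE.
    have /andP[_ /=] := sub (maxn t0 h.+1) (introT andP (conj (leq_maxl _ _) isT)).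
    by rewrite geq_max ltnn andbF.
  have hasN : has (predC P) (iota t0 (M.+1 - t0)) by rewrite has_predC.
  set i := find _ _.
  have lt_i : i < M.+1 - t0 by move: hasN; rewrite has_find size_iota.
  have nPi : ~~ P (t0 + i) by have := nth_find 0 hasN; rewrite nth_iota.
  have Pi t : t0 <= t -> t < t0 + i -> P t.
    move=> le_t lt_t; have lt_ti : t - t0 < i by rewrite ltn_subLR.
    have := before_find 0 lt_ti; rewrite nth_iota ?(ltn_trans lt_ti) //.
    by rewrite subnKC //= => /negbFE.
  have i0 : 0 < i by rewrite lt0n; apply: contraNneq nPi => ->; rewrite addn0.
  have inE t : in_itv (t0, Some (t0 + i).-1) t = (t0 <= t < t0 + i).
    by rewrite /in_itv /=; case: i i0 {lt_i nPi Pi} => // i _; rewrite addnS ltnS.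
  have in0 : in_itv (t0, Some (t0 + i).-1) t0.
    by rewrite inE leqnn -[X in X < _]addn0 ltn_add2l.
  split; first by exists t0.
    by move=> t; rewrite inE => /andP[]; apply: Pi.
  move=> [lo hi] sub PJ'.
  have /andP[/= lo_t0 hi_t0] := sub _ in0.
  have loE : lo = t0.
    apply/eqP; rewrite eqn_leq lo_t0 /=.
    apply: (lowP (lo, hi)) => //; first exact: sub.
    rewrite /in_itv leqnn /=; case: hi hi_t0 {sub PJ'} => //= h.
    exact: leq_trans.
  rewrite loE in sub PJ' *; case: hi hi_t0 sub PJ' => [h|] /= hi_t0 sub PJ'.
    congr (_, Some _); apply/eqP; rewrite eqn_leq; apply/andP; split.
      rewrite -ltnS prednK ?addn_gt0 ?i0 ?orbT // ltnNge; apply: contra nPi.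
      by move=> le_h; apply: PJ'; rewrite /in_itv /= leq_addr.
    have in1 : in_itv (t0, Some (t0 + i).-1) (t0 + i).-1.
      by rewrite inE; case: i i0 {lt_i nPi Pi inE in0 sub} => // i _;
        rewrite addnS /= leq_addr ltnSn.
    by have /andP[] := sub _ in1.
  by case/negP: nPi; apply: PJ'; rewrite /in_itv /= leq_addr.
case: J => lo hi [[t /andP[/= lo_t t_hi]] PJ maxJ].
have in_lo : in_itv (lo, hi) lo.
  by rewrite /in_itv /= leqnn; case: (hi) t_hi => //= h; apply: leq_trans.
have Plo := PJ _ in_lo.
have blo : (lo == 0) || ~~ P lo.-1.
  case: lo => [|lo] //= in lo_t PJ maxJ in_lo Plo *.
  apply/negP=> Pl.
  have [] // : (lo, hi) = (lo.+1, hi).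
    apply: maxJ => u; first by case/andP=> /= /ltnW lou hiu; apply/andP.
    case/andP=> /=; rewrite leq_eqVlt => /predU1P[<- //|lou] hiu.
    by apply: PJ; apply/andP.
  by move/eqP; rewrite ltn_eqF.
have bhi h : hi = Some h -> ~~ P h.+1.
  move=> hE; apply/negP=> Ph; rewrite hE in PJ maxJ in_lo.
  have [] // : (lo, Some h.+1) = (lo, Some h).
    apply: maxJ => u.
      by case/andP=> /= lou hu; apply/andP; split=> //=; apply: leqW.
    case/andP=> /= lou; rewrite leq_eqVlt => /predU1P[-> //|hu].
    by apply: PJ; apply/andP.
  by move/eqP; rewrite gtn_eqF.
have leM : lo <= M.
  rewrite leqNgt; apply/negP=> ltM; case/orP: blo => [/eqP lo0|].
    by rewrite lo0 in ltM.
  have leM : M <= lo.-1 by case: (lo) ltM.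
  by rewrite (cP _ leM) -(cP lo (ltnW ltM)) Plo.
apply/mapP; exists lo.
  by rewrite mem_filter mem_iota /= Plo blo add0n ltnS.
congr pair; case: ifPn => [/allP allP|nall].
  case: hi PJ maxJ bhi in_lo {t_hi} => // h PJ maxJ bhi /andP[_ /= lo_h].
  case/negP: (bhi h erefl); case: (leqP h.+1 M) => [le_hM|/ltnW /cP ->].
    by apply: allP; rewrite mem_iota leqW //= subnKC ?ltnS // leqW.
  by apply: allP; rewrite mem_iota leM subnKC ?ltnSn // leqW.
have hasN : has (predC P) (iota lo (M.+1 - lo)) by rewrite has_predC.
set i := find _ _.
have lt_i : i < M.+1 - lo by move: hasN; rewrite has_find size_iota.
have nPi : ~~ P (lo + i) by have := nth_find 0 hasN; rewrite nth_iota.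
case: hi PJ maxJ bhi in_lo {t_hi} => [h|] PJ maxJ bhi /andP[_ /= lo_h]; last first.
  by case/negP: nPi; apply: PJ; rewrite /in_itv /= leq_addr.
congr Some; suff -> : lo + i = h.+1 by [].
apply/eqP; rewrite eqn_leq; apply/andP; split.
  rewrite leqNgt; apply/negP=> lt_h.
  have lt_hi : h.+1 - lo < i by rewrite ltn_subLR // leqW.
  have := before_find 0 lt_hi; rewrite nth_iota ?(ltn_trans lt_hi) //.
  by rewrite subnKC ?leqW //= (bhi h).
rewrite ltnNge; apply: contra nPi => le_h.
by apply: PJ; rewrite /in_itv /= leq_addr.
Qed.

Lemma maximal_itvs_sorted (P : pred nat) (M : nat) :
  sorted ltn [seq J.1 | J <- maximal_itvs P M].
Proof.
rewrite /maximal_itvs -map_comp (eq_map (g := id)) // map_id.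
by apply: sorted_filter; [apply: ltn_trans | apply: iota_ltn_sorted].
Qed.

(** A loop of the edge relation plays no role: traversing it is a wait. *)
Record instance (V : finType) (k : nat) := Instance {
  edge : rel V;
  edge_sym : symmetric edge;
  start : 'I_k -> V;
  goals : 'I_k -> {set V};
  goals_neq0 : forall a, goals a != set0
}.

(** The vertex sequence of a path of agent [a] is [start I a :: p]; only [p] is
    stored, so that the cost of the path is [size p]. *)
Definition is_agent_path (V : finType) (k : nat) (I : instance V k) (a : 'I_k)
    (p : seq V) : bool :=
  [&& path (fun u v => (u == v) || edge I u v) (start I a) p,
      [forall g in goals I a, g \in start I a :: p]
    & last (start I a) p \in goals I a].

(** The position at time [t]; after the end of its path the agent stays at the
    last vertex. *)
Definition position (V : finType) (k : nat) (I : instance V k) (a : 'I_k)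
    (p : seq V) (t : nat) : V :=
  nth (last (start I a) p) (start I a :: p) t.

(** [inl (a, t, v)] is a vertex constraint, [inr (a, t, u, v)] an edge
    constraint. *)
Definition constraint (V : finType) (k : nat) : Type :=
  (('I_k * nat * V) + ('I_k * nat * V * V))%type.

Definition constraint_agent (V : finType) (k : nat) (c : constraint V k) : 'I_k :=
  match c with inl (a, _, _) => a | inr (a, _, _, _) => a end.

Definition constraint_time (V : finType) (k : nat) (c : constraint V k) : nat :=
  match c with inl (_, t, _) => t | inr (_, t, _, _) => t end.

(** [collision I P t c1 c2]: under the paths [P] two agents collide at time [t]
    (between [t] and [t.+1] for an edge conflict), and [c1] and [c2] are the
    constraints forbidding the part of the first and of the second agent. *)
Inductive collision (V : finType) (k : nat) (I : instance V k)
    (P : 'I_k -> seq V) : nat -> constraint V k -> constraint V k -> Prop :=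
| vertex_conflict (i j : 'I_k) (t : nat) (v : V) :
    i != j ->
    position I i (P i) t = v ->
    position I j (P j) t = v ->
    collision I P t (inl (i, t, v)) (inl (j, t, v))
| edge_conflict (i j : 'I_k) (t : nat) (u v u' v' : V) :
    i != j ->
    u != v ->
    position I i (P i) t = u -> position I i (P i) t.+1 = v ->
    position I j (P j) t = u' -> position I j (P j) t.+1 = v' ->
    [set u; v] = [set u'; v'] ->
    collision I P t (inr (i, t, u, v)) (inr (j, t, u', v')).

Definition collision_free (V : finType) (k : nat) (I : instance V k)
    (P : 'I_k -> seq V) : Prop :=
  forall t c1 c2, ~ collision I P t c1 c2.

Definition is_solution (V : finType) (k : nat) (I : instance V k)
    (P : 'I_k -> seq V) : Prop :=
  (forall a, is_agent_path I a (P a)) /\ collision_free I P.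

Definition soc (V : finType) (k : nat) (P : 'I_k -> seq V) : nat :=
  \sum_(a < k) size (P a).

(** No constraint of [cs] has a time [>= horizon cs]. *)
Definition horizon (V : finType) (k : nat) (cs : seq (constraint V k)) : nat :=
  \max_(c <- cs) (constraint_time c).+1.

Definition safe (V : finType) (k : nat) (cs : seq (constraint V k)) (a : 'I_k)
    (v : V) (t : nat) : bool :=
  inl (a, t, v) \notin cs.

Definition move_allowed (V : finType) (k : nat) (cs : seq (constraint V k))
    (a : 'I_k) (u v : V) (t : nat) : bool :=
  inr (a, t, u, v) \notin cs.

Definition tis (V : finType) : Type := (itv * V)%type.

Definition safe_itvs (V : finType) (k : nat) (cs : seq (constraint V k))
    (a : 'I_k) (v : V) : seq (tis V) :=
  [seq (J, v) | J <- maximal_itvs (safe cs a v) (horizon cs)].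

Definition goal_safe_itvs (V : finType) (k : nat) (I : instance V k)
    (cs : seq (constraint V k)) (a : 'I_k) : seq (tis V) :=
  flatten [seq safe_itvs cs a g | g <- enum (goals I a)].

(** A node stores its parent itself: a parent has been removed from [U], and
    such a node is never modified again. *)
Inductive node (V : finType) : Type :=
  Node of tis V & option nat & option (node V).

Definition node_tis (V : finType) (n : node V) : tis V :=
  let: Node q _ _ := n in q.

Definition node_cost (V : finType) (n : node V) : option nat :=
  let: Node _ c _ := n in c.

Definition node_parent (V : finType) (n : node V) : option (node V) :=
  let: Node _ _ par := n in par.

(** The nodes in [U] and the nodes already removed from it. *)
Definition tree (V : finType) : Type := (seq (node V) * seq (node V))%type.

Definition tree_init (V : finType) (k : nat) (cs : seq (constraint V k))
    (a : 'I_k) (seed : tis V) : tree V :=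
  ([seq Node q (if q == seed then Some 0 else None) None
      | q <- flatten [seq safe_itvs cs a v | v <- enum V]], [::]).

(** The predicate is constant from the given bound on. *)
Definition covering_itvs (V : finType) (k : nat) (cs : seq (constraint V k))
    (a : 'I_k) (n : node V) (v' : V) : seq itv :=
  let: (J, v) := node_tis n in
  maximal_itvs
    (fun t => [&& safe cs a v' t, in_itv J t.+1 & move_allowed cs a v' v t])
    (maxn (horizon cs) (maxn J.1 (odflt 0 J.2))).

(** Update of [m] by the node [n] and one of the covering intervals [b]: the
    part of [m] inside [b] gets the parent [n], the parts before and after [b]
    are split off unchanged. *)
Definition cover_node (V : finType) (n : node V) (b : itv) (m : node V) :
    seq (node V) :=
  let: Node (J, v') c par := m in
  let c' := ext_add (node_cost n) (Some 1) in
  let lo := maxn J.1 b.1 in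
  let hi := ext_min J.2 b.2 in
  if ext_lt c' c && ext_le (Some lo) hi then
    (if J.1 < b.1 then [:: Node ((J.1, Some b.1.-1), v') c par] else [::])
    ++ Node ((lo, hi), v') c' (Some n)
    :: (if b.2 is Some h then
          if ext_lt (Some h) J.2 then [:: Node ((h.+1, J.2), v') c par] else [::]
        else [::])
  else [:: m].

Definition relax (V : finType) (k : nat) (I : instance V k)
    (cs : seq (constraint V k)) (a : 'I_k) (n m : node V) : seq (node V) :=
  let v := (node_tis n).2 in
  let v' := (node_tis m).2 in
  if (v' == v) || edge I v' v then
    foldl (fun ms b => flatten [seq cover_node n b m' | m' <- ms])
      [:: m] (covering_itvs cs a n v')
  else [:: m].

(** Only nodes of [U] are relaxed: the removed ones cost at most [node_cost n]. *)
Inductive tree_step (V : finType) (k : nat) (I : instance V k)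
    (cs : seq (constraint V k)) (a : 'I_k) : tree V -> tree V -> Prop :=
| tree_pop (U1 U2 D : seq (node V)) (n : node V) :
    all (fun m => ext_le (node_cost n) (node_cost m)) (U1 ++ U2) ->
    tree_step I cs a (U1 ++ n :: U2, D)
      (flatten [seq relax I cs a n m | m <- U1 ++ U2], n :: D).

(** A TIS Forest: the seeds with their trees. *)
Definition forest (V : finType) : Type := seq (tis V * tree V).

Definition forest_init (V : finType) (k : nat) (I : instance V k)
    (cs : seq (constraint V k)) (a : 'I_k) : forest V :=
  [seq (q, tree_init cs a q) | q <- goal_safe_itvs I cs a].

Definition forest_complete (V : finType) (F : forest V) : bool :=
  all (fun qT => nilp qT.2.1) F.

Definition query (V : finType) (F : forest V) (q : tis V) (t : nat) (v : V) :
    option (node V) :=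
  ohead [seq n <- flatten [seq qT.2.2 | qT <- F & qT.1 == q]
           | ((node_tis n).2 == v) && in_itv (node_tis n).1 t].

Definition query_cost (V : finType) (F : forest V) (q : tis V) (t : nat)
    (v : V) : option nat :=
  if query F q t v is Some n then node_cost n else None.

(** The vertices following that of [n] on the way to the seed. *)
Fixpoint node_path (V : finType) (n : node V) : seq V :=
  let: Node _ _ par := n in
  if par is Some m then (node_tis m).2 :: node_path m else [::].

(** The distance of two vertices in the same connected component (where it is
    smaller than [#|V|]). *)
Definition dist (V : finType) (e : rel V) (x y : V) : nat :=
  find (fun n => [exists p : n.-tuple V, path e x p && (last x p == y)])
    (iota 0 #|V|).

Definition pair_adj (V : finType) (F : {set {set V}}) : rel V :=
  fun x y => [set x; y] \in F.

(** A spanning tree, given by its set of unordered pairs, of the graph on [S]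
    joining any two distinct vertices at finite distance. *)
Definition spanning_tree (V : finType) (e : rel V) (S : {set V})
    (F : {set {set V}}) : bool :=
  [&& [forall f in F, exists x in S, exists y in S,
         [&& x != y, connect e x y & f == [set x; y]]],
      [forall x in S, forall y in S, connect (pair_adj F) x y]
    & [forall n : 'I_#|V|.+1, forall c : n.-tuple V,
         ucycleb (pair_adj F) c ==> (size c <= 2)]].

(** The length of a pair [f] is the distance of its two elements. *)
Definition tree_weight (V : finType) (e : rel V) (F : {set {set V}}) : nat :=
  \sum_(f in F) \max_(x in f) \max_(y in f) dist e x y.

Definition mst_cost (V : finType) (e : rel V) (S : {set V}) : option nat :=
  if [pick F | spanning_tree e S F] is Some F0 then
    Some (tree_weight e
            [arg min_(F < F0 | spanning_tree e S F) tree_weight e F])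
  else None.

(** Visited goals, current safe interval, [g]-value, and the state it was reached
    from. The latter is closed, hence never modified, when it is stored. *)
Inductive astate (V : finType) : Type :=
  AState of {set V} & tis V & nat & option (astate V).

Definition visited (V : finType) (s : astate V) : {set V} :=
  let: AState L _ _ _ := s in L.

Definition current (V : finType) (s : astate V) : tis V :=
  let: AState _ p _ _ := s in p.

Definition gval (V : finType) (s : astate V) : nat :=
  let: AState _ _ g _ := s in g.

Definition same_state (V : finType) (s s' : astate V) : bool :=
  (visited s == visited s') && (current s == current s').

Definition fval (V : finType) (k : nat) (I : instance V k) (a : 'I_k)
    (s : astate V) : option nat :=
  ext_add (Some (gval s))
    (mst_cost (edge I) ((current s).2 |: (goals I a :\: visited s))).

(** The list of safe intervals is increasing and, the constraints being
    finitely many, never empty. *)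
Definition astate_init (V : finType) (k : nat) (I : instance V k)
    (cs : seq (constraint V k)) (a : 'I_k) : astate V :=
  AState set0
    (head ((0, None), start I a) (safe_itvs cs a (start I a))) 0 None.

Definition transition_allowed (V : finType) (k : nat) (I : instance V k)
    (cs : seq (constraint V k)) (a : 'I_k) (s : astate V) (q : tis V) : bool :=
  (q.2 \notin visited s) &&
  ((goals I a :\: visited s == [set q.2]) ==>
     (q == last q (safe_itvs cs a q.2))).

Definition successors (V : finType) (k : nat) (I : instance V k)
    (cs : seq (constraint V k)) (a : 'I_k) (F : forest V) (s : astate V) :
    seq (astate V) :=
  pmap (fun q =>
      omap (fun d => AState (q.2 |: visited s) q (gval s + d) (Some s))
        (query_cost F q (gval s) (current s).2))
    [seq q <- goal_safe_itvs I cs a | transition_allowed I cs a s q].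

Definition insert_open (V : finType) (closed open : seq (astate V))
    (s : astate V) : seq (astate V) :=
  if has (same_state s) closed then open
  else if has (same_state s) open then
    [seq if same_state s s' && (gval s < gval s') then s else s' | s' <- open]
  else s :: open.

Fixpoint visiting_order (V : finType) (s : astate V) : seq (tis V) :=
  let: AState _ p _ back := s in
  if back is Some s' then rcons (visiting_order s') p else [::].

Fixpoint build_path (V : finType) (F : forest V) (t : nat) (v : V)
    (qs : seq (tis V)) : seq V :=
  if qs is q :: qs' then
    let p := if query F q t v is Some n then node_path n else [::] in
    p ++ build_path F (t + size p) q.2 qs'
  else [::].

Inductive low_state (V : finType) : Type :=
| LBuild (F : forest V)
| LSearch (F : forest V) (open closed : seq (astate V))
| LDone (result : option (seq V)).

Definition low_init (V : finType) (k : nat) (I : instance V k)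
    (cs : seq (constraint V k)) (a : 'I_k) : low_state V :=
  LBuild (forest_init I cs a).

(** The choices left open by the algorithms are resolved nondeterministically,
    here and below. *)
Inductive low_step (V : finType) (k : nat) (I : instance V k)
    (cs : seq (constraint V k)) (a : 'I_k) : low_state V -> low_state V -> Prop :=
| low_build (F1 F2 : forest V) (q : tis V) (T T' : tree V) :
    tree_step I cs a T T' ->
    low_step I cs a (LBuild (F1 ++ (q, T) :: F2)) (LBuild (F1 ++ (q, T') :: F2))
| low_start (F : forest V) :
    forest_complete F ->
    low_step I cs a (LBuild F) (LSearch F [:: astate_init I cs a] [::])
| low_fail (F : forest V) (closed : seq (astate V)) :
    low_step I cs a (LSearch F [::] closed) (LDone None)
| low_goal (F : forest V) (O1 O2 closed : seq (astate V)) (s : astate V) :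
    all (fun s' => ext_le (fval I a s) (fval I a s')) (O1 ++ O2) ->
    goals I a \subset visited s ->
    low_step I cs a (LSearch F (O1 ++ s :: O2) closed)
      (LDone (Some (build_path F 0 (start I a) (visiting_order s))))
| low_expand (F : forest V) (O1 O2 closed : seq (astate V)) (s : astate V) :
    all (fun s' => ext_le (fval I a s) (fval I a s')) (O1 ++ O2) ->
    ~~ (goals I a \subset visited s) ->
    low_step I cs a (LSearch F (O1 ++ s :: O2) closed)
      (LSearch F
         (foldl (insert_open (s :: closed)) (O1 ++ O2) (successors I cs a F s))
         (s :: closed)).

Record ct_node (V : finType) (k : nat) := CTNode {
  ct_constraints : seq (constraint V k);
  ct_paths : 'I_k -> seq V
}.

Definition set_path (V : finType) (k : nat) (P : 'I_k -> seq V) (a : 'I_k)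
    (p : seq V) : 'I_k -> seq V :=
  fun b => if b == a then p else P b.

(** [MRoot] and [MRootCall] compute the paths of the root, for the agents in
    [todo]; [MExpand] and [MExpandCall] form the children of [N], for the
    constraints in [todo]. [l] is the state of a running low-level solver. *)
Inductive mgcbs_state (V : finType) (k : nat) : Type :=
| MRoot (P : 'I_k -> seq V) (todo : seq 'I_k)
| MRootCall (P : 'I_k -> seq V) (a : 'I_k) (todo : seq 'I_k) (l : low_state V)
| MSelect (open : seq (ct_node V k))
| MExpand (open : seq (ct_node V k)) (N : ct_node V k)
    (todo : seq (constraint V k))
| MExpandCall (open : seq (ct_node V k)) (N : ct_node V k) (c : constraint V k)
    (todo : seq (constraint V k)) (l : low_state V)
| MReturned (result : option ('I_k -> seq V)).

Definition mgcbs_init (V : finType) (k : nat) : mgcbs_state V k :=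
  MRoot (fun _ => [::]) (enum 'I_k).

Inductive mgcbs_step (V : finType) (k : nat) (I : instance V k) :
    mgcbs_state V k -> mgcbs_state V k -> Prop :=
| root_call P a todo :
    mgcbs_step I (MRoot P (a :: todo)) (MRootCall P a todo (low_init I [::] a))
| root_low P a todo l l' :
    low_step I [::] a l l' ->
    mgcbs_step I (MRootCall P a todo l) (MRootCall P a todo l')
| root_path P a todo p :
    mgcbs_step I (MRootCall P a todo (LDone (Some p)))
      (MRoot (set_path P a p) todo)
| root_no_path P a todo :
    mgcbs_step I (MRootCall P a todo (LDone None)) (MReturned None)
| root_done P :
    mgcbs_step I (MRoot P [::]) (MSelect [:: CTNode [::] P])
| select_empty :
    mgcbs_step I (MSelect [::]) (MReturned None)
| select_return O1 O2 (N : ct_node V k) :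
    all (fun N' => soc (ct_paths N) <= soc (ct_paths N')) (O1 ++ O2) ->
    collision_free I (ct_paths N) ->
    mgcbs_step I (MSelect (O1 ++ N :: O2)) (MReturned (Some (ct_paths N)))
| select_branch O1 O2 (N : ct_node V k) t c1 c2 :
    all (fun N' => soc (ct_paths N) <= soc (ct_paths N')) (O1 ++ O2) ->
    collision I (ct_paths N) t c1 c2 ->
    (forall t' c1' c2', collision I (ct_paths N) t' c1' c2' -> t <= t') ->
    mgcbs_step I (MSelect (O1 ++ N :: O2)) (MExpand (O1 ++ O2) N [:: c1; c2])
| expand_call O N c todo :
    mgcbs_step I (MExpand O N (c :: todo))
      (MExpandCall O N c todo
         (low_init I (c :: ct_constraints N) (constraint_agent c)))
| expand_low O N c todo l l' :
    low_step I (c :: ct_constraints N) (constraint_agent c) l l' ->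
    mgcbs_step I (MExpandCall O N c todo l) (MExpandCall O N c todo l')
| expand_path O N c todo p :
    mgcbs_step I (MExpandCall O N c todo (LDone (Some p)))
      (MExpand
         (CTNode (c :: ct_constraints N)
            (set_path (ct_paths N) (constraint_agent c) p) :: O) N todo)
| expand_no_path O N c todo :
    mgcbs_step I (MExpandCall O N c todo (LDone None)) (MExpand O N todo)
| expand_done O N :
    mgcbs_step I (MExpand O N [::]) (MSelect O).

Inductive reachable (S : Type) (step : S -> S -> Prop) (s : S) : S -> Prop :=
| reachable_refl : reachable step s s
| reachable_step s1 s2 : reachable step s s1 -> step s1 s2 -> reachable step s s2.

(** There is no infinite run from [s]. *)
Definition terminates (S : Type) (step : S -> S -> Prop) (s : S) : Prop :=
  Acc (fun s2 s1 => step s1 s2) s.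

Definition final (S : Type) (step : S -> S -> Prop) (s : S) : Prop :=
  forall s', ~ step s s'.

(* Main.v *)
(** The low-level solver is a sound and optimal solver for one agent. Since a
    node of a TIS Tree is removed from [U] in order of increasing cost, the tree is
    a backward breadth-first search in the time-expanded graph, and a query returns
    a shortest safe walk into the seed. It is finite because splitting preserves
    the number of pairs (time up to the horizon, vertex) covered by [U], every node
    covers at least one of them, and removing a node uncovers its pairs. In the A*
    search, an earlier arrival in a safe interval dominates a later one, as the
    agent may wait; and adding one edge to a spanning tree shows that the heuristic
    is consistent, so closed states have optimal [g]-values.

    Fix a solution [Ps] of sum of costs [C]. A collision of [Ps] would be needed to
    violate both constraints of a branching, so OPEN always contains a node whose
    constraints [Ps] respects, hence one of cost at most [C]. All expanded nodes
    therefore have cost at most [C], their earliest collision occurs by time [C],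
    and the constraint added in a child is new, since the paths of a node respect
    its constraints. There are finitely many constraints up to time [C], so the
    constraint tree is finite; it can only stop at a collision-free node. *)

Require Import Defs.
From mathcomp Require Import all_boot.
From mathcomp Require Import zify.
From HB Require Import structures.
From mathcomp Require Import boolp.

Set Implicit Arguments.
Unset Strict Implicit.
Unset Printing Implicit Defensive.

(** * Total correctness *)

(** Termination and correctness of final states in one inductive predicate. A run of the low-level
    solver embedded in a run of MGCBS can then be treated by induction on the derivation of
    [ensures] for the inner run. *)
Inductive ensures (S : Type) (step : S -> S -> Prop) (Q : S -> Prop) (s : S) :
    Prop :=
| ensures_intro :
    (forall s', step s s' -> ensures step Q s') ->
    (final step s -> Q s) -> ensures step Q s.

Lemma ensures_terminates (S : Type) (step : S -> S -> Prop) Q s :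
  ensures step Q s -> terminates step s.
Proof. by elim=> {}s _ IH _; constructor=> s' /IH. Qed.

Lemma ensures_reachable (S : Type) (step : S -> S -> Prop) Q s s' :
  ensures step Q s -> reachable step s s' -> ensures step Q s'.
Proof. by move=> es; elim=> [//|s1 s2 _ [IH _] /IH]. Qed.

Lemma ensures_final (S : Type) (step : S -> S -> Prop) Q s :
  ensures step Q s -> final step s -> Q s.
Proof. by case. Qed.

(** The second alternative for [s'] lets a phase that decreases [mu] hand over to a later phase for
    which [ensures] is already known. *)
Lemma ensures_measure (S : Type) (step : S -> S -> Prop) (Q Inv : S -> Prop)
    (mu : S -> nat) :
  (forall s s', Inv s -> step s s' ->
     (Inv s' /\ mu s' < mu s) \/ ensures step Q s') ->
  (forall s, Inv s -> final step s -> Q s) ->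
  forall s, Inv s -> ensures step Q s.
Proof.
move=> stepP finP s; have [m] := ubnP (mu s).
elim: m s => [|m IH] s lt_m Is; first by rewrite ltn0 in lt_m.
constructor; last exact: finP.
move=> s' /(stepP _ _ Is)[[Is' lt_mu]|//].
by apply: IH Is'; apply: leq_trans lt_mu _.
Qed.

(** * Extended numbers and intervals *)

Lemma ext_le_refl x : ext_le x x.
Proof. by case: x => //= n. Qed.

Lemma ext_le_trans y x z : ext_le x y -> ext_le y z -> ext_le x z.
Proof. by case: x y z => [x|] [y|] [z|] //=; lia. Qed.

Lemma ext_le_total x y : ext_le x y || ext_le y x.
Proof. by case: x y => [x|] [y|] //=; lia. Qed.

Lemma ext_ltW x y : ext_lt x y -> ext_le x y.
Proof. by rewrite /ext_lt; have := ext_le_total y x; case: (ext_le y x). Qed.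

Lemma ext_le_min t x y : ext_le (Some t) (ext_min x y) =
  ext_le (Some t) x && ext_le (Some t) y.
Proof. by case: x y => [x|] [y|]; rewrite /ext_min /= ?andbT //;
  case: ifP; rewrite /=; lia. Qed.

(** Used for progress: a nonempty list always offers the split demanded by the step constructors
    that select a minimum. *)
Lemma ext_argmin (T : Type) (f : T -> option nat) (s : seq T) :
  ~~ nilp s -> exists s1 x s2,
    s = s1 ++ x :: s2 /\ all (fun y => ext_le (f x) (f y)) (s1 ++ s2).
Proof.
elim: s => // x s IH _; have [/nilP ->|/IH] := boolP (nilp s).
  by exists [::], x, [::].
case=> s1 [y [s2 [-> ally]]]; have [le_yx|] := boolP (ext_le (f y) (f x)).
  by exists (x :: s1), y, s2; rewrite /= le_yx.
move/ext_ltW=> le_xy; exists [::], x, (s1 ++ y :: s2); split=> //=.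
rewrite all_cat /= le_xy /= -all_cat; apply: sub_all ally => z.
exact: ext_le_trans.
Qed.

Section Intervals.
Variables (P : pred nat) (M : nat).
Hypothesis P_const : forall t, M <= t -> P t = P M.

Lemma maximal_itvs_cover t : P t -> exists2 J, J \in maximal_itvs P M & in_itv J t.
Proof.
move=> Pt.
(* [t0] is the beginning of the run of [P] that contains [t]. *)
have [t0 [le_t0 P_t0 b_t0]] : exists t0, [/\ t0 <= t,
    forall u, t0 <= u <= t -> P u & (t0 == 0) || ~~ P t0.-1].
  elim: t Pt => [|t IH] Pt.
    exists 0; split=> // u; rewrite leqn0 /= => /eqP->; exact: Pt.
  have [/IH [t0 [le0 P0 b0]]|nPt] := boolP (P t).
    exists t0; split=> //; first exact: leqW.
    move=> u /andP[le_u]; rewrite leq_eqVlt => /predU1P[-> //|lt_u].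
    by apply: P0; rewrite le_u.
  exists t.+1; split=> // u; rewrite -eqn_leq => /eqP <- //.
have Pt0 : P t0 by apply: P_t0; rewrite leqnn.
(* A run beginning after [M] would need a change of [P] after [M]. *)
have le_M : t0 <= M.
  rewrite leqNgt; apply/negP=> lt_M; have M_le : M <= t0.-1 by lia.
  move: b_t0; rewrite (P_const M_le) -(P_const (ltnW lt_M)) Pt0 orbF.
  by move/eqP=> E; rewrite E in lt_M.
pose J := (t0, if all P (iota t0 (M.+1 - t0)) then None
            else Some (t0 + find (predC P) (iota t0 (M.+1 - t0))).-1) : itv.
have J_in : J \in maximal_itvs P M.
  by apply/mapP; exists t0; rewrite // mem_filter Pt0 b_t0 mem_iota add0n ltnS.
exists J => //; rewrite /J /in_itv /= le_t0 /=; case: ifP => //= /negbT nall.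
rewrite -has_predC in nall; have := nth_find 0 nall.
have lt_i : find (predC P) (iota t0 (M.+1 - t0)) < M.+1 - t0.
  by move: nall; rewrite has_find size_iota.
rewrite nth_iota //=; set i := find _ _ => nPi.
have : ~~ (t0 + i <= t) by apply: contra nPi => le_i; apply: P_t0; lia.
by lia.
Qed.

(** The hull of two intervals with a common time is contained in their union, so [P] holds on it and
    maximality identifies both intervals with it. *)
Lemma maximal_itv_eq J1 J2 t :
  is_maximal_itv P J1 -> is_maximal_itv P J2 -> in_itv J1 t -> in_itv J2 t ->
  J1 = J2.
Proof.
move=> [_ P1 max1] [_ P2 max2] t1 t2.
pose J : itv := (minn J1.1 J2.1, if ext_le J1.2 J2.2 then J2.2 else J1.2).
have sub1 u : in_itv J1 u -> in_itv J u.
  by rewrite /in_itv /J; case: (J1) (J2) => [l1 [h1|]] [l2 [h2|]];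
    rewrite /=; try case: ifP; lia.
have sub2 u : in_itv J2 u -> in_itv J u.
  by rewrite /in_itv /J; case: (J1) (J2) => [l1 [h1|]] [l2 [h2|]];
    rewrite /=; try case: ifP; lia.
have PJ u : in_itv J u -> P u.
  have [in1|n1] := boolP (in_itv J1 u); first by move=> _; apply: P1.
  have [in2|n2] := boolP (in_itv J2 u); first by move=> _; apply: P2.
  move: n1 n2 t1 t2; rewrite /in_itv /J; case: (J1) (J2) => [l1 [h1|]] [l2 [h2|]];
    rewrite /=; try case: ifP; lia.
by rewrite -(max1 J sub1 PJ) (max2 J sub2 PJ).
Qed.

Lemma maximal_itvs_inj J1 J2 t :
  J1 \in maximal_itvs P M -> J2 \in maximal_itvs P M ->
  in_itv J1 t -> in_itv J2 t -> J1 = J2.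
Proof.
by move=> /(maximal_itvsP _ P_const) m1 /(maximal_itvsP _ P_const); apply: maximal_itv_eq.
Qed.

Lemma maximal_itvs_sub J t : J \in maximal_itvs P M -> in_itv J t -> P t.
Proof. by case/(maximal_itvsP _ P_const)=> _ + _; apply. Qed.

Lemma maximal_itvs_lo J : J \in maximal_itvs P M -> in_itv J J.1.
Proof.
case/(maximal_itvsP _ P_const)=> [[t]] + _ _; rewrite /in_itv leqnn /=.
by case: J => lo [hi|] //=; lia.
Qed.

Lemma maximal_itvs_lo_pred J :
  J \in maximal_itvs P M -> J.1 = 0 \/ ~~ P J.1.-1.
Proof.
by case/mapP=> t; rewrite mem_filter => /andP[/andP[_ /orP[/eqP|]]] + _ -> /=; auto.
Qed.

Lemma maximal_itvs_hi J h :
  J \in maximal_itvs P M -> J.2 = Some h -> P h /\ ~~ P h.+1.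
Proof.
move=> JP; have loJ := maximal_itvs_lo JP; have PJ t := @maximal_itvs_sub J t JP.
case/(maximal_itvsP _ P_const): JP => _ _; case: J loJ PJ => lo hi /= loJ PJ maxJ hE.
rewrite hE in loJ PJ maxJ; split; first by apply: PJ; move: loJ; rewrite /in_itv /=; lia.
apply/negP=> Ph; suff: (lo, Some h.+1) = (lo, Some h) by case; lia.
apply: maxJ => t; rewrite /in_itv /=; first by lia.
case/andP=> le_t; rewrite leq_eqVlt => /predU1P[-> //|lt_t].
by apply: PJ; rewrite /in_itv /= le_t.
Qed.

Lemma head_maximal_itvs J x0 :
  J \in maximal_itvs P M -> in_itv J 0 -> head x0 (maximal_itvs P M) = J.
Proof.
move=> JP J0; have := maximal_itvs_sorted P M.
have := @maximal_itvs_inj J; move: JP.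
case: (maximal_itvs P M) => //= J' s; rewrite inE => JP inj srt.
case/predU1P: JP inj => [-> //|Js] inj.
move: srt; rewrite (path_sortedE ltn_trans) => /andP[/allP /(_ J.1)].
by rewrite map_f //= => /(_ isT); move: J0; rewrite /in_itv; lia.
Qed.

(** The interval containing [M] is unbounded since [P] is constant from [M] on. As starting times
    increase along the list, the last interval starts inside this one and hence equals it. *)
Lemma last_maximal_itvs x0 :
  P M ->
  last x0 (maximal_itvs P M) \in maximal_itvs P M /\ (last x0 (maximal_itvs P M)).2 = None.
Proof.
move=> PM; have [J JP JM] := maximal_itvs_cover PM.
have J2 : J.2 = None.
  case E: J.2 => [h|] //; have [Ph nPh] := maximal_itvs_hi JP E.
  have le_h : M <= h.+1 by move: JM; rewrite /in_itv E /=; lia.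
  by rewrite (P_const le_h) PM in nPh.
have lastM : last x0 (maximal_itvs P M) \in maximal_itvs P M.
  by case: (maximal_itvs P M) JP => //= *; apply: mem_last.
suff -> : last x0 (maximal_itvs P M) = J by [].
have le_J : J.1 <= (last x0 (maximal_itvs P M)).1.
  have := maximal_itvs_sorted P M; move: JP {lastM}.
  case: (lastP (maximal_itvs P M)) => // s J'.
  rewrite last_rcons mem_rcons inE map_rcons -cats1 (sorted_pairwise ltn_trans).
  rewrite pairwise_cat => /predU1P[-> //|Js] /andP[/allrelP /(_ J.1 J'.1)].
  by rewrite map_f // inE eqxx => /(_ isT isT) /ltnW.
apply/esym/(maximal_itvs_inj JP lastM _ (maximal_itvs_lo lastM)).
by rewrite /in_itv le_J J2.
Qed.

End Intervals.

(** * Timed walks *)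

(** A classical equality on nodes, for list membership in the proofs; the algorithm itself never
    compares nodes. *)
HB.instance Definition _ (V : finType) := gen_eqMixin (node V).

Section Agent.
Variables (V : finType) (k : nat) (I : instance V k).
Variables (cs : seq (constraint V k)) (a : 'I_k).

Lemma horizonP c : c \in cs -> constraint_time c < horizon cs.
Proof. by move=> c_cs; apply: (leq_bigmax_seq (F := fun c => (constraint_time c).+1)). Qed.

Lemma safe_horizon v t : horizon cs <= t -> safe cs a v t.
Proof. by move=> le_t; apply/negP=> /horizonP /=; rewrite ltnNge le_t. Qed.

Lemma move_allowed_horizon u v t : horizon cs <= t -> move_allowed cs a u v t.
Proof. by move=> le_t; apply/negP=> /horizonP /=; rewrite ltnNge le_t. Qed.

Lemma safe_const v t : horizon cs <= t -> safe cs a v t = safe cs a v (horizon cs).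
Proof. by move=> le_t; rewrite !safe_horizon. Qed.

Definition transition (t : nat) (u v : V) : bool :=
  [&& (u == v) || edge I u v, safe cs a u t, safe cs a v t.+1
    & move_allowed cs a u v t].

(** An empty walk is accepted even at an unsafe point; safety of the starting point is stated
    separately where it matters. *)
Fixpoint walk (t : nat) (u : V) (p : seq V) : bool :=
  if p is v :: p' then transition t u v && walk t.+1 v p' else true.

Lemma walk_cat t u p1 p2 :
  walk t u (p1 ++ p2) = walk t u p1 && walk (t + size p1) (last u p1) p2.
Proof.
elim: p1 t u => [|v p1 IH] t u /=; first by rewrite addn0.
by rewrite IH addnS andbA.
Qed.

Lemma safe_itvs_inj q q' t :
  q \in safe_itvs cs a q.2 -> q' \in safe_itvs cs a q'.2 -> q.2 = q'.2 ->
  in_itv q.1 t -> in_itv q'.1 t -> q = q'.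
Proof.
case: q q' => [J v] [J' v'] /= /mapP[J1 J1P [->]] /mapP[J2 J2P [->]] E.
move: J1P J2P; rewrite -E => J1P J2P tJ tJ'.
by rewrite (maximal_itvs_inj (@safe_const v) J1P J2P tJ tJ').
Qed.

Lemma safe_itvs_safe q t :
  q \in safe_itvs cs a q.2 -> in_itv q.1 t -> safe cs a q.2 t.
Proof.
case: q => [J v] /= /mapP[J1 J1P [->]].
exact: (maximal_itvs_sub (@safe_const v)).
Qed.

Lemma safe_itvs_cover v t :
  safe cs a v t -> exists J, (J, v) \in safe_itvs cs a v /\ in_itv J t.
Proof.
move=> /(maximal_itvs_cover (@safe_const v))[J JP Jt].
by exists J; split=> //; apply: map_f.
Qed.

Lemma mem_safe_itvs q v : q \in safe_itvs cs a v -> q.2 = v.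
Proof. by case/mapP=> J _ ->. Qed.

Lemma mem_goal_safe_itvs q :
  (q \in goal_safe_itvs I cs a) = (q.2 \in goals I a) && (q \in safe_itvs cs a q.2).
Proof.
apply/flatten_mapP/andP => [[g gG qg]|[gG qg]].
  by rewrite (mem_safe_itvs qg) -mem_enum.
by exists q.2; rewrite ?mem_enum.
Qed.

(** * Safe-interval trees *)

Definition has_point (n : node V) (t : nat) (v : V) : bool :=
  ((node_tis n).2 == v) && in_itv (node_tis n).1 t.

(** Such an interval is nonempty and starts by the horizon, so [tree_measure] sees it. A finite end
    lies strictly before the horizon, so a piece split off behind it still starts by the horizon. *)
Definition bounded_itv (J : itv) : bool :=
  (J.1 <= horizon cs) && (if J.2 is Some h then J.1 <= h < horizon cs else true).

Lemma maximal_itvs_bounded J v :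
  J \in maximal_itvs (safe cs a v) (horizon cs) -> bounded_itv J.
Proof.
move=> JP; have loJ := maximal_itvs_lo (@safe_const v) JP.
have hiJ h := @maximal_itvs_hi _ _ (@safe_const v) J h JP.
rewrite /bounded_itv; apply/andP; split.
  case/mapP: JP => t; rewrite mem_filter mem_iota add0n ltnS => /andP[_ le_t] -> //.
case E: J.2 => [h|] //; move: loJ; rewrite /in_itv E /= leqnn /= => -> /=.
have [_] := hiJ h E; apply: contraR; rewrite -leqNgt => le_h.
by apply: safe_horizon; apply: leqW.
Qed.

(** * The times at which a vertex leads into a given node *)

Section Covering.
Variables (n : node V) (v' : V).

Definition covered (t : nat) : bool :=
  [&& safe cs a v' t, in_itv (node_tis n).1 t.+1
    & move_allowed cs a v' (node_tis n).2 t].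

Let M := maxn (horizon cs) (maxn (node_tis n).1.1 (odflt 0 (node_tis n).1.2)).

Lemma covering_itvsE : covering_itvs cs a n v' = maximal_itvs covered M.
Proof. by rewrite /M /covered; case: (n) => [[J v] c p]. Qed.

Lemma covered_const t : M <= t -> covered t = covered M.
Proof.
rewrite /M !geq_max => /and3P[le_t].
rewrite /covered !safe_horizon ?leq_maxl ?move_allowed_horizon ?leq_maxl //= !andbT.
rewrite /in_itv; case: (node_tis n).1 => lo [hi|] /=; lia.
Qed.

Lemma covering_itvs_cover t :
  covered t -> exists2 b, b \in covering_itvs cs a n v' & in_itv b t.
Proof. by rewrite covering_itvsE; exact: (maximal_itvs_cover (@covered_const)). Qed.

Lemma covering_itvs_sub b t :
  b \in covering_itvs cs a n v' -> in_itv b t -> covered t.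
Proof. by rewrite covering_itvsE; exact: (maximal_itvs_sub (@covered_const)). Qed.

(** From the horizon on no constraint applies, and [t.+1] lies in the bounded interval of [n] either
    always or never. So [covered] is constant there, and no covering interval begins after the
    horizon or ends at or after it. *)
Lemma covering_itvs_bounded b :
  bounded_itv (node_tis n).1 -> b \in covering_itvs cs a n v' -> bounded_itv b.
Proof.
rewrite covering_itvsE => bn bP; have lob := maximal_itvs_lo (@covered_const) bP.
have lo_pred := maximal_itvs_lo_pred bP.
have cov_lo := maximal_itvs_sub (@covered_const) bP lob.
have hi h := @maximal_itvs_hi _ _ (@covered_const) b h bP.
have coveredE t : horizon cs <= t -> covered t = in_itv (node_tis n).1 t.+1.
  by move=> le_t; rewrite /covered safe_horizon // move_allowed_horizon //= andbT.
move: bn; rewrite /bounded_itv /in_itv => bn; apply/andP; split.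
  rewrite leqNgt; apply/negP=> lt_lo; case: lo_pred => [E|]; first by rewrite E in lt_lo.
  rewrite coveredE; last by (move: lt_lo; case: (b.1)).
  move: cov_lo; rewrite coveredE; last exact: ltnW.
  rewrite /in_itv; case: (node_tis n).1 bn => lo1 [hi1|] /=; lia.
case E: b.2 => [h|] //; move: lob; rewrite /in_itv E /= leqnn /= => -> /=.
have [ch nch] := hi h E; rewrite ltnNge; apply/negP=> le_h.
move: ch nch; rewrite !coveredE; [|lia|lia].
rewrite /in_itv; case: (node_tis n).1 bn => lo1 [hi1|] /=; lia.
Qed.

End Covering.

Definition leads_to (n : node V) (v' : V) (t : nat) : bool :=
  ((v' == (node_tis n).2) || edge I v' (node_tis n).2) && covered n v' t.

(** What relaxation by [n] may do to [m], formulated transitively so that it composes along the fold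
    over the covering intervals. *)
Definition part_of (n m m' : node V) : Prop :=
  [/\ (node_tis m').2 = (node_tis m).2,
      forall t, in_itv (node_tis m').1 t -> in_itv (node_tis m).1 t,
      ext_le (node_cost m') (node_cost m)
    & node_cost m' = node_cost m /\ node_parent m' = node_parent m \/
      exists c, [/\ node_cost n = Some c, node_cost m' = Some c.+1,
        node_parent m' = Some n &
        forall t, in_itv (node_tis m').1 t -> leads_to n (node_tis m).2 t]].

Lemma part_of_refl n m : part_of n m m.
Proof. by split; auto; apply: ext_le_refl. Qed.

Lemma part_of_trans n m1 m2 m3 :
  part_of n m1 m2 -> part_of n m2 m3 -> part_of n m1 m3.
Proof.
case=> e12 s12 l12 c12 [e23 s23 l23 c23]; split.
- by rewrite e23.
- by move=> t /s23 /s12.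
- exact: ext_le_trans l12.
case: c23 => [[-> ->]|[c [? ? ? cov]]]; last by right; exists c; rewrite -e12.
case: c12 => [|[c [? ? ? cov]]]; [by left | right; exists c; split=> //].
by move=> t /s23; apply: cov.
Qed.

(** Counting, instead of testing membership, expresses that splitting is a partition, which yields
    both the coverage of safe points and the tree measure. Vertices may be ignored because the
    pieces of a node share its vertex. *)
Definition pieces_count (s : seq (node V)) (t : nat) : nat :=
  \sum_(m <- s) in_itv (node_tis m).1 t.

Lemma pieces_count_cat s1 s2 t :
  pieces_count (s1 ++ s2) t = pieces_count s1 t + pieces_count s2 t.
Proof. exact: big_cat. Qed.

Lemma cover_node_count n b m t :
  bounded_itv b ->
  pieces_count (cover_node n b m) t = in_itv (node_tis m).1 t.
Proof.
case: b => lb hb bb.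
case: m => [[[lo hi] v'] c par]; rewrite /cover_node /pieces_count.
case: ifP => [/andP[_ le_lh]|_]; last by rewrite big_seq1.
rewrite big_cat big_cons /=.
move: le_lh bb; rewrite /bounded_itv /ext_min /in_itv /ext_lt.
case: hb hi => [hb|] [hi|] /=; do ?[case: ifP => /=]; rewrite ?big_seq1 ?big_nil /=; lia.
Qed.

Lemma cover_node_bounded (n : node V) b (m m' : node V) :
  bounded_itv b -> bounded_itv (node_tis m).1 -> m' \in cover_node n b m ->
  bounded_itv (node_tis m').1.
Proof.
case: b => lb hb bb; case: m => [[[lo hi] v'] c par] bm; rewrite /cover_node.
case: ifP => [/andP[_ le_lh]|_]; last by rewrite mem_seq1 => /eqP->.
move: bb bm le_lh; rewrite /bounded_itv /ext_min /ext_lt mem_cat inE.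
case: hb hi => [hb|] [hi|] /=; do ?[case: ifP => /=]; rewrite ?inE ?orbF /=;
  move=> *; repeat match goal with
    | H : is_true (_ || _) |- _ => case/orP: H
    | H : is_true (_ == _) |- _ => move/eqP: H => ->
    | |- is_true (_ == _) -> _ => move=> /eqP ->
    | |- is_true (_ || _) -> _ => case/orP
    end; rewrite /=; lia.
Qed.

(** The pieces split off before and after [b] miss [b], and the middle piece receives the new cost.
    If nothing is split, then either [m] misses [b] or its cost is low enough already. *)
Lemma cover_node_part (n : node V) b (m m' : node V) :
  (forall t, in_itv b t -> leads_to n (node_tis m).2 t) ->
  m' \in cover_node n b m ->
  part_of n m m' /\
  (forall t, in_itv b t -> in_itv (node_tis m').1 t ->
     ext_le (node_cost m') (ext_add (node_cost n) (Some 1))).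
Proof.
case: b => lb hb; case: m => [[[lo hi] v'] c par] bP; rewrite /cover_node.
case: ifP => [/andP[lt_c]|]; last first.
  move=> nrel; rewrite mem_seq1 => /eqP->; split; first exact: part_of_refl.
  move=> t; move: nrel; rewrite /ext_lt /ext_min /in_itv /=.
  case: (node_cost n) c hb hi {bP} => [cn|] [c|] [hb|] [hi|] //=;
    do ?[case: ifP => /=]; lia.
rewrite ext_le_min /= => ov.
case cnE: (node_cost n) lt_c => [cn|] /= lt_c; last by case: (c) lt_c.
have le_c : ext_le (Some cn.+1) c by rewrite -addn1; apply: ext_ltW.
rewrite mem_cat inE => /or3P[|/eqP->|].
- case: ifP => // lt_lb; rewrite mem_seq1 => /eqP->; split.
    split=> //=; auto; last exact: ext_le_refl.
    by move=> t; rewrite /in_itv /=; case: (hi) ov => [h|] /=; lia.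
  by move=> t; rewrite /in_itv /=; lia.
- split; last by move=> t _ _ /=; rewrite leqnn.
  have sub t : in_itv (maxn lo lb, ext_min hi hb) t ->
      in_itv (lo, hi) t /\ in_itv (lb, hb) t.
    by rewrite /in_itv ext_le_min /= geq_max; case/and3P=> /andP[-> ->] -> ->.
  split=> //=; try by move=> t /sub[].
    by rewrite addn1.
  right; exists cn; rewrite addn1; split=> //= t /sub[_]; exact: bP.
case: hb bP ov => // hb bP ov; case: ifP => // lt_hb; rewrite mem_seq1 => /eqP->; split.
  split=> //=; auto; last exact: ext_le_refl.
  by move=> t; rewrite /in_itv /=; case: (hi) ov => [h|] /=; lia.
by move=> t; rewrite /in_itv /=; lia.
Qed.

Section Relax.
Variable n : node V.
Hypothesis n_bounded : bounded_itv (node_tis n).1.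

(** Induction from the end of [bs], matching [foldl]. The cost bounds obtained for earlier intervals
    survive because later splittings only shrink intervals and lower costs. *)
Lemma relax_fold (bs : seq itv) (m : node V) :
  {in bs, forall b, bounded_itv b /\
     forall t, in_itv b t -> leads_to n (node_tis m).2 t} ->
  bounded_itv (node_tis m).1 ->
  let ms := foldl (fun ms b => flatten [seq cover_node n b m' | m' <- ms])
    [:: m] bs in
  [/\ {in ms, forall m', bounded_itv (node_tis m').1},
      forall t, pieces_count ms t = in_itv (node_tis m).1 t,
      {in ms, forall m', part_of n m m'}
    & {in ms, forall m' b t, b \in bs -> in_itv b t -> in_itv (node_tis m').1 t ->
         ext_le (node_cost m') (ext_add (node_cost n) (Some 1))}].
Proof.
elim/last_ind: bs => [|bs b IH] bsP bm /=.
  split=> // [m'|t|m'].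
  - by rewrite mem_seq1 => /eqP->.
  - by rewrite /pieces_count big_seq1.
  - by rewrite mem_seq1 => /eqP->; apply: part_of_refl.
have [b_bd bP] : bounded_itv b /\ forall t, in_itv b t -> leads_to n (node_tis m).2 t.
  by apply: bsP; rewrite mem_rcons mem_head.
have {IH} [||bd cnt part cost] := IH => //.
  by move=> b' b'bs; apply: bsP; rewrite mem_rcons inE b'bs orbT.
rewrite foldl_rcons; set ms := foldl _ _ _ in bd cnt part cost *.
split.
- by move=> m' /flatten_mapP[m1 /bd]; apply: cover_node_bounded.
- move=> t; rewrite -cnt /pieces_count big_flatten big_map; apply: eq_bigr => m1 _.
  exact: cover_node_count.
- move=> m' /flatten_mapP[m1 m1P] /cover_node_part [].
    by case: (part _ m1P) => ->.
  by move=> + _; apply: part_of_trans; apply: part.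
move=> m' /flatten_mapP[m1 m1P] /cover_node_part [].
  by case: (part _ m1P) => ->.
move=> [_ sub le_c _] new b' t; rewrite mem_rcons inE => /predU1P[->|b'bs] tb tm.
  exact: new tb tm.
exact: ext_le_trans le_c (cost _ m1P b' t b'bs tb (sub _ tm)).
Qed.

Lemma relaxP (m : node V) :
  bounded_itv (node_tis m).1 ->
  [/\ {in relax I cs a n m, forall m', bounded_itv (node_tis m').1},
      forall t, pieces_count (relax I cs a n m) t = in_itv (node_tis m).1 t,
      {in relax I cs a n m, forall m', part_of n m m'}
    & {in relax I cs a n m, forall m' t,
         leads_to n (node_tis m).2 t -> in_itv (node_tis m').1 t ->
         ext_le (node_cost m') (ext_add (node_cost n) (Some 1))}].
Proof.
move=> bm; rewrite /relax; case: ifP => [adj|nadj]; last first.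
  split=> [m'|t|m'|m' _ t]; last by rewrite /leads_to nadj.
  - by rewrite mem_seq1 => /eqP->.
  - by rewrite /pieces_count big_seq1.
  - by rewrite mem_seq1 => /eqP->; apply: part_of_refl.
have [||bd cnt part cost] := @relax_fold (covering_itvs cs a n (node_tis m).2) m.
- move=> b bP; split; first exact: covering_itvs_bounded bP.
  by move=> t /(covering_itvs_sub bP); rewrite /leads_to adj.
- exact: bm.
split=> // m' m'P t /andP[_ /covering_itvs_cover[b bP bt]]; exact: cost bP bt.
Qed.

End Relax.

(** * Invariant, optimality and termination of a single tree *)

Section Tree.
Variable seed : tis V.
Hypothesis seedP : seed \in safe_itvs cs a seed.2.

(** A certificate that the parent pointers describe safe walks into the seed from every time of the
    node. [sound_seed] admits subintervals of the seed so that the predicate is closed under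
    [part_of]. *)
Inductive sound_node : node V -> Prop :=
| sound_unreached q :
    (forall t, in_itv q.1 t -> safe cs a q.2 t) -> sound_node (Node q None None)
| sound_seed q :
    q.2 = seed.2 -> (forall t, in_itv q.1 t -> in_itv seed.1 t) ->
    sound_node (Node q (Some 0) None)
| sound_step q c m :
    sound_node m -> node_cost m = Some c ->
    (forall t, in_itv q.1 t ->
       transition t q.2 (node_tis m).2 /\ in_itv (node_tis m).1 t.+1) ->
    sound_node (Node q (Some c.+1) (Some m)).

Lemma sound_node_safe n t :
  sound_node n -> in_itv (node_tis n).1 t -> safe cs a (node_tis n).2 t.
Proof.
case=> [q qS|q E qS|q c m _ _ qS] /=; first exact: qS.
  by rewrite E => /qS; apply: safe_itvs_safe.
by case/qS=> /and4P[].
Qed.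

Lemma sound_node_walk n t c :
  sound_node n -> in_itv (node_tis n).1 t -> node_cost n = Some c ->
  [/\ walk t (node_tis n).2 (node_path n), size (node_path n) = c,
      last (node_tis n).2 (node_path n) = seed.2 & in_itv seed.1 (t + c)].
Proof.
move=> sn; elim: sn t c => [q _|q E qS|q c' m _ IH E qS] t c //=.
  by move=> tq [<-]; rewrite addn0; split=> //; apply: qS.
move=> tq [<-]; have [tr tm] := qS t tq.
by have [w -> -> s] := IH _ _ tm E; rewrite tr w addnS.
Qed.

Lemma sound_node_part n m m' :
  (forall t, in_itv (node_tis n).1 t -> safe cs a (node_tis n).2 t) ->
  sound_node n -> sound_node m -> part_of n m m' -> sound_node m'.
Proof.
move=> nS sn sm; case: m' => [[J' v'] c' par'] [/= E sub _ [[]|[c [nc -> -> lead]]]].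
  case: sm E sub => [q qS|q Eq qS|q c m0 sm0 E0 qS] /= -> sub -> ->.
  - by apply: sound_unreached => t /sub /qS.
  - by apply: sound_seed => // t /sub /qS.
  by apply: sound_step => // t /sub /qS.
apply: sound_step => // t tJ; case/andP: (lead t tJ) => adj /and3P[? tn ?].
by rewrite /= E; split=> //; apply/and4P; split=> //; apply: nS.
Qed.

(** The invariant of Dijkstra's algorithm with unit lengths, stated for points instead of nodes
    since nodes get split. Once [U] is empty, the fourth clause bounds the decrease of the cost
    along every transition by one. *)
Definition tree_inv (T : tree V) : Prop :=
  [/\ {in T.1 ++ T.2, forall n, bounded_itv (node_tis n).1 /\ sound_node n},
      forall t v, safe cs a v t -> exists2 n, n \in T.1 ++ T.2 & has_point n t v,
      {in T.2 & T.1, forall n m, ext_le (node_cost n) (node_cost m)},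
      {in T.1 ++ T.2 & T.2, forall n m t u v, has_point n t u ->
         has_point m t.+1 v -> transition t u v ->
         ext_le (node_cost n) (ext_add (node_cost m) (Some 1))}
    & {in T.1 ++ T.2, forall n t, has_point n t seed.2 -> in_itv seed.1 t ->
         node_cost n = Some 0}].

Lemma tree_init_inv : tree_inv (tree_init cs a seed).
Proof.
have inP n : n \in (tree_init cs a seed).1 ->
    exists q, n = Node q (if q == seed then Some 0 else None) None /\
      q \in safe_itvs cs a q.2.
  case/mapP=> q /flatten_mapP[v _ qv] ->; exists q; split=> //.
  by rewrite (mem_safe_itvs qv).
rewrite /tree_inv /= cats0; split=> //.
- move=> n /inP[q [-> qP]] /=; split.
    move: qP; case: (q) => J v /= /mapP[J' J'P [->]].
    exact: maximal_itvs_bounded J'P.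
  case: eqP => [->|_]; first exact: sound_seed.
  by apply: sound_unreached => t; apply: safe_itvs_safe.
- move=> t v /safe_itvs_cover[J [Jv Jt]].
  exists (Node (J, v) (if (J, v) == seed then Some 0 else None) None).
    apply: map_f; apply/flatten_mapP; exists v => //; exact: mem_enum.
  by rewrite /has_point eqxx.
move=> n /inP[q [-> qP]] t /andP[/= /eqP E tq] ts.
by rewrite (safe_itvs_inj qP seedP E tq ts) eqxx.
Qed.

Lemma relax_all_part n U m' :
  bounded_itv (node_tis n).1 -> {in U, forall m, bounded_itv (node_tis m).1} ->
  m' \in flatten [seq relax I cs a n m | m <- U] ->
  exists m, [/\ m \in U, m' \in relax I cs a n m & part_of n m m'].
Proof.
move=> bn bU /flatten_mapP[m mU m'P]; exists m; split=> //.
by have [_ _ part _] := relaxP bn (bU m mU); apply: part.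
Qed.

Lemma has_point_part n m m' t v :
  part_of n m m' -> has_point m' t v -> has_point m t v.
Proof. by case=> E sub _ _; rewrite /has_point E => /andP[-> /sub]. Qed.

Lemma tree_step_inv T T' : tree_inv T -> tree_step I cs a T T' -> tree_inv T'.
Proof.
move=> + st; case: st => U1 U2 D n min_n [] /= sound cov mono rel zero.
have inU m : m \in U1 ++ U2 -> m \in (U1 ++ n :: U2) ++ D.
  by rewrite !mem_cat inE => /orP[]->; rewrite ?orbT.
have inU0 m : m \in U1 ++ U2 -> m \in U1 ++ n :: U2.
  by rewrite !mem_cat inE => /orP[]->; rewrite ?orbT.
have inD m : m \in D -> m \in (U1 ++ n :: U2) ++ D.
  by rewrite mem_cat => ->; rewrite orbT.
have nU : n \in U1 ++ n :: U2 by rewrite mem_cat mem_head orbT.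
have nT : n \in (U1 ++ n :: U2) ++ D by rewrite mem_cat nU.
have [bn sn] := sound n nT.
have nS t : in_itv (node_tis n).1 t -> safe cs a (node_tis n).2 t.
  exact: sound_node_safe.
have bU : {in U1 ++ U2, forall m, bounded_itv (node_tis m).1}.
  by move=> m /inU /sound[].
have partP m' : m' \in flatten [seq relax I cs a n m | m <- U1 ++ U2] ->
    exists m, [/\ m \in U1 ++ U2, m' \in relax I cs a n m & part_of n m m'].
  exact: relax_all_part.
have le_n1 : ext_le (node_cost n) (ext_add (node_cost n) (Some 1)).
  by case: (node_cost n) => //= c; rewrite leq_addr.
have le_min m : m \in U1 ++ U2 -> ext_le (node_cost n) (node_cost m).
  exact: (allP min_n).
split.
- move=> m' /=; rewrite mem_cat inE => /or3P[/partP[m [mU m'P pm]]|/eqP->|/inD/sound] //.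
  split; first by have [bd _ _ _] := relaxP bn (bU m mU); apply: bd.
  by apply: sound_node_part pm => //; case: (sound m (inU m mU)).
- move=> t v /cov[m mT mp]; move: mT; rewrite /= mem_cat mem_cat inE.
  have [E _|m_n /=] := eqVneq m n; first by exists m; rewrite // E mem_cat mem_head orbT.
  rewrite -mem_cat; case/orP=> [mU|mD]; last by exists m; rewrite // mem_cat inE mD !orbT.
  have [_ cnt part _] := relaxP bn (bU m mU); case/andP: mp => /eqP Ev tm.
  (* The pieces count [t] as often as [m] does, so one of them contains it. *)
  have : has (fun m' => in_itv (node_tis m').1 t) (relax I cs a n m).
    apply: contraTT tm => /hasPn no; rewrite -eqb0 -cnt /pieces_count big_seq big1 //.
    by move=> m' /no /negbTE ->.
  case/hasP=> m' m'P tm'; exists m'.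
    by rewrite mem_cat; apply/orP; left; apply/flatten_mapP; exists m.
  by rewrite /has_point tm'; case: (part m' m'P) => -> _ _ _; rewrite Ev eqxx.
- move=> n' m' /= n'D /partP[m [mU _ [_ _ _ cost]]].
  have le_n' : ext_le (node_cost n') (node_cost n).
    by move: n'D; rewrite inE => /predU1P[->|/mono]; [apply: ext_le_refl | apply].
  apply: ext_le_trans le_n' _; case: cost => [[-> _]|[c [-> -> _ _]]] /=.
    exact: le_min.
  exact: leqnSn.
- move=> n' m' /= n'T; rewrite inE => m'D t u v pn' pm' tr.
  (* A node removed earlier costs at most [node_cost n], which settles the new case where [m'] is
     [n]. *)
  have old : n' \in n :: D -> ext_le (node_cost n') (ext_add (node_cost m') (Some 1)).
    move=> n'D; case/predU1P: m'D => [->|m'D]; last first.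
      apply: rel pn' pm' tr => //; move: n'D; rewrite inE => /predU1P[-> //|]; exact: inD.
    move: n'D; rewrite inE => /predU1P[-> //|n'D].
    by apply: ext_le_trans le_n1; apply: mono.
  move: n'T; rewrite mem_cat => /orP[|//] /partP[m [mU n'P pm]].
  case/predU1P: m'D => [E|m'D]; last first.
    case: (pm) => _ _ le_c _; apply: ext_le_trans le_c _.
    by apply: rel (has_point_part pm pn') pm' tr => //; apply: inU.
  subst m'; have [_ _ _ cost] := relaxP bn (bU m mU).
  have /andP[/eqP Eu _] := has_point_part pm pn'; have /andP[_ tn'] := pn'.
  case/andP: pm' => /eqP Ev tn; case/and4P: tr => adj s1 _ mv.
  apply: (cost n' n'P t _ tn'); apply/andP; rewrite Eu Ev; split=> //.
  by apply/and3P; rewrite Ev.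
move=> n' /= n'T t pn' ts; move: n'T; rewrite mem_cat => /orP[|n'D]; last first.
  apply: zero pn' ts; move: n'D; rewrite inE => /predU1P[-> //|]; exact: inD.
case/partP=> m [mU _ pm]; case: (pm) => _ _ + _.
rewrite (zero m (inU m mU) t (has_point_part pm pn') ts).
by case: (node_cost n') => //= -[].
Qed.

(** Induction along the walk: each transition accounts for one unit of cost by the fourth clause of
    the invariant, and the walk ends at a point of cost zero. *)
Lemma tree_complete_cost D p t v n :
  tree_inv ([::], D) -> n \in D -> has_point n t v ->
  walk t v p -> last v p = seed.2 -> in_itv seed.1 (t + size p) ->
  ext_le (node_cost n) (Some (size p)).
Proof.
case=> /= _ cov _ rel zero; elim: p t v n => [|u p IH] t v n nD nt /=.
  by rewrite addn0 => _ E ts; rewrite E in nt; rewrite (zero n nD t nt ts).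
case/andP=> tr w E; rewrite addnS -addSn => ts; have /and4P[_ _ su _] := tr.
have [m mD mt] := cov t.+1 u su; apply: ext_le_trans (rel n m nD mD t v u nt mt tr) _.
have := IH _ _ m mD mt w E ts; by case: (node_cost m) => //= c; rewrite addn1.
Qed.

(** The horizon itself is included because an unbounded interval may start there. *)
Definition tree_measure (T : tree V) : nat :=
  \sum_(t < (horizon cs).+1) pieces_count T.1 t.

Lemma tree_step_measure T T' :
  tree_inv T -> tree_step I cs a T T' -> tree_measure T' < tree_measure T.
Proof.
move=> + st; case: st => U1 U2 D n _ [/= sound _ _ _ _].
have bU m : m \in U1 ++ n :: U2 -> bounded_itv (node_tis m).1.
  by move=> mU; have [|//] := sound m; rewrite mem_cat mU.
have inU m : m \in U1 ++ U2 -> m \in U1 ++ n :: U2.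
  by rewrite !mem_cat inE => /orP[]->; rewrite ?orbT.
have bn : bounded_itv (node_tis n).1 by apply: bU; rewrite mem_cat mem_head orbT.
have E t : pieces_count (flatten [seq relax I cs a n m | m <- U1 ++ U2]) t =
    pieces_count (U1 ++ U2) t.
  rewrite /pieces_count big_flatten big_map big_seq [RHS]big_seq.
  apply: eq_bigr => m /inU /bU bm; have [_ cnt _ _] := relaxP bn bm; exact: cnt.
rewrite /tree_measure /= (eq_bigr _ (fun (i : 'I__) _ => E i)).
have -> : \sum_(t < (horizon cs).+1) pieces_count (U1 ++ n :: U2) t =
    \sum_(t < (horizon cs).+1) in_itv (node_tis n).1 t +
    \sum_(t < (horizon cs).+1) pieces_count (U1 ++ U2) t.
  rewrite -big_split; apply: eq_bigr => t _.
  by rewrite !pieces_count_cat {2}/pieces_count big_cons addnCA.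
rewrite -[X in X < _]add0n ltn_add2r.
move: bn; rewrite /bounded_itv => /andP[lo hi].
(* The starting time of [n] is a counted time that is lost when [n] is removed. *)
rewrite (bigD1 (Ordinal (n := (horizon cs).+1) (m := (node_tis n).1.1) lo)) //=.
apply: ltn_addr; rewrite lt0b /in_itv leqnn /=.
by case: (node_tis n).1.2 hi => //= h /andP[].
Qed.

Lemma tree_progress T : ~~ nilp T.1 -> exists T', tree_step I cs a T T'.
Proof.
case: T => U D /= /(ext_argmin (@node_cost V))[U1 [n [U2 [-> min_n]]]].
by eexists; constructor.
Qed.

End Tree.

Definition forest_inv (F : forest V) : Prop :=
  [seq qT.1 | qT <- F] = goal_safe_itvs I cs a /\
  {in F, forall qT, tree_inv qT.1 qT.2}.

Lemma forest_init_inv : forest_inv (forest_init I cs a).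
Proof.
split; first by rewrite /forest_init -map_comp map_id_in.
move=> _ /mapP[q + ->]; rewrite mem_goal_safe_itvs => /andP[_ qP].
exact: tree_init_inv.
Qed.

Lemma forest_step_inv F1 F2 q T T' :
  forest_inv (F1 ++ (q, T) :: F2) -> tree_step I cs a T T' ->
  forest_inv (F1 ++ (q, T') :: F2).
Proof.
case=> seeds inv st; split; first by rewrite -seeds !map_cat.
have qT : (q, T) \in F1 ++ (q, T) :: F2 by rewrite mem_cat mem_head orbT.
move=> [q' T1]; rewrite mem_cat inE => /or3P[qF|/eqP[-> ->]|qF] /=.
- by apply: (inv (q', T1)); rewrite mem_cat qF.
- apply: tree_step_inv st; last exact: (inv (q, T)).
  have : q \in goal_safe_itvs I cs a by rewrite -seeds; apply: (map_f fst qT).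
  by rewrite mem_goal_safe_itvs => /andP[].
by apply: (inv (q', T1)); rewrite mem_cat inE qF !orbT.
Qed.

Definition forest_measure (F : forest V) : nat :=
  \sum_(qT <- F) tree_measure qT.2.

Lemma forest_step_measure F1 F2 q T T' :
  forest_inv (F1 ++ (q, T) :: F2) -> tree_step I cs a T T' ->
  forest_measure (F1 ++ (q, T') :: F2) < forest_measure (F1 ++ (q, T) :: F2).
Proof.
case=> _ inv st; rewrite /forest_measure !big_cat !big_cons /=.
rewrite ltn_add2l ltn_add2r; apply: tree_step_measure st.
by apply: (inv (q, T)); rewrite mem_cat mem_head orbT.
Qed.

(** * Queries in a completed forest *)

Section Query.
Variable F : forest V.
Hypotheses (F_inv : forest_inv F) (F_complete : forest_complete F).

Lemma query_node q t v n :
  query F q t v = Some n ->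
  has_point n t v /\ exists D, [/\ (q, ([::], D)) \in F, n \in D & tree_inv q ([::], D)].
Proof.
rewrite /query; set s := [seq n <- _ | _] => Es.
have : n \in s by case: (s) Es => //= m s' [->]; rewrite mem_head.
rewrite mem_filter => /andP[nt /flatten_mapP[[q' [U D]]]].
rewrite mem_filter => /andP[/= /eqP -> qF nD]; split=> //.
have /nilP /= EU := allP F_complete _ qF; rewrite EU in qF.
by exists D; split=> //; have [_ /(_ _ qF)] := F_inv.
Qed.

Lemma query_sound q t v n c :
  query F q t v = Some n -> node_cost n = Some c ->
  [/\ walk t v (node_path n), size (node_path n) = c,
      last v (node_path n) = q.2, in_itv q.1 (t + c) & safe cs a v t].
Proof.
case/query_node=> /andP[/eqP <- tn] [D [qF nD [/= sound _ _ _ _]]] nc.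
have qP : q \in safe_itvs cs a q.2.
  have : q \in goal_safe_itvs I cs a by have [<- _] := F_inv; apply: (map_f fst qF).
  by rewrite mem_goal_safe_itvs => /andP[].
have [_ sn] := sound n nD; have [? ? ? ?] := sound_node_walk sn tn nc.
by split=> //; apply: sound_node_safe sn tn.
Qed.

Lemma query_optimal q t v p :
  q \in goal_safe_itvs I cs a -> safe cs a v t ->
  walk t v p -> last v p = q.2 -> in_itv q.1 (t + size p) ->
  exists2 c, query_cost F q t v = Some c & c <= size p.
Proof.
move=> qG sv w E tq; have [seeds inv] := F_inv.
move: qG; rewrite -seeds => /mapP[[q' [U D]] qF /= Eq]; subst q'.
have /nilP /= EU := allP F_complete _ qF; subst U.
have [_ /(_ t v sv)[m /= mD mt] _ _ _] := inv _ qF.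
rewrite /query_cost; case Eq: (query F q t v) => [n|].
  (* The answer may come from any tree listed under the seed [q]; each satisfies the invariant. *)
  have [nt [D' [_ nD' inv']]] := query_node Eq.
  have := tree_complete_cost inv' nD' nt w E tq.
  by case: (node_cost n) => //= c; exists c.
move: Eq; rewrite /query; set s := [seq n <- _ | _] => Es.
have : m \in s.
  rewrite mem_filter; apply/andP; split=> //; apply/flatten_mapP.
  by exists (q, ([::], D)); rewrite // mem_filter eqxx.
by case: (s) Es.
Qed.

End Query.
End Agent.

(** * Minimum spanning trees *)

Section SpanningTrees.
Variables (V : finType) (e : rel V).
Hypothesis e_sym : symmetric e.
Implicit Types (S : {set V}) (F : {set {set V}}).

Lemma dist_le x y p : path e x p -> last x p = y -> dist e x y <= size p.
Proof.
move=> xp yp; rewrite leqNgt; apply/negP=> lt_p.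
(* [find] never exceeds the length of the searched list, so a path shorter than [dist] has one of
   the tested lengths. *)
have lt_V : size p < #|V|.
  by apply: leq_trans lt_p _; rewrite /dist -[X in _ <= X](size_iota 0); apply: find_size.
have := before_find 0 lt_p; rewrite nth_iota // add0n //= => /negbT/negP[].
by apply/existsP; exists (in_tuple p); rewrite xp yp eqxx.
Qed.

Lemma distxx x : dist e x x = 0.
Proof. by apply/eqP; rewrite -leqn0 -[0]/(size (Nil V)); apply: dist_le. Qed.

Lemma pair_adj_sym F : symmetric (pair_adj F).
Proof. by move=> x y; rewrite /pair_adj setUC. Qed.

Lemma spanning_tree_pair S F f :
  spanning_tree e S F -> f \in F ->
  exists x y, [/\ x \in S, y \in S, x != y, connect e x y & f = [set x; y]].
Proof.
case/and3P=> /forall_inP + _ _ fF => /(_ f fF) /exists_inP[x xS] /exists_inP[y yS].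
by case/and3P=> xy cxy /eqP ->; exists x, y.
Qed.

Lemma pair_adj_mem S F x y :
  spanning_tree e S F -> pair_adj F x y -> x \in S /\ y \in S.
Proof.
move=> st /(spanning_tree_pair st)[u [v [uS vS _ _ E]]].
have: x \in [set u; v] by rewrite -E !inE eqxx.
have: y \in [set u; v] by rewrite -E !inE eqxx orbT.
by rewrite !inE => /orP[]/eqP-> /orP[]/eqP->.
Qed.

Lemma spanning_tree1 x : spanning_tree e [set x] set0.
Proof.
apply/and3P; split.
- by apply/forall_inP=> f; rewrite inE.
- by apply/forall_inP=> u /set1P->; apply/forall_inP=> v /set1P->; apply: connect0.
apply/forallP=> n; apply/forallP=> -[[|u c] /= cP] //=; apply/implyP=> /andP[/=].
by rewrite rcons_path /pair_adj inE andbF.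
Qed.

(** The new vertex [x] has [y] as its only neighbour. A simple cycle through [x] therefore has at
    most two vertices, and a cycle avoiding [x] already lies in [F]. *)
Lemma spanning_tree_leaf S F x y :
  spanning_tree e S F -> x \notin S -> y \in S -> connect e x y ->
  spanning_tree e (x |: S) ([set x; y] |: F).
Proof.
move=> st xS yS cxy; have adjP := pair_adj_mem st.
have x_y : x != y by apply: contraNneq xS => ->.
have adjx z : pair_adj ([set x; y] |: F) x z -> z = y.
  rewrite /pair_adj in_setU1 => /orP[/eqP/setP/(_ y)|/adjP[]]; last by rewrite (negbTE xS).
  by rewrite !inE eqxx orbT eq_sym (negbTE x_y) => /eqP.
have con_y u : u \in x |: S -> connect (pair_adj ([set x; y] |: F)) u y.
  case/setU1P=> [->|uS]; first by apply: connect1; rewrite /pair_adj setU11.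
  have /and3P[_ /forall_inP/(_ u uS)/forall_inP/(_ y yS) + _] := st.
  apply: connect_sub => v w vw; apply: connect1; exact: setU1r.
apply/and3P; split.
- apply/forall_inP=> f /setU1P[->|/(spanning_tree_pair st)[u [v [uS vS uv cuv ->]]]].
    apply/exists_inP; exists x; first exact: setU11.
    by apply/exists_inP; exists y; [apply: setU1r | rewrite x_y cxy eqxx].
  apply/exists_inP; exists u; first exact: setU1r.
  by apply/exists_inP; exists v; [apply: setU1r | rewrite uv cuv eqxx].
- apply/forall_inP=> u /con_y uy; apply/forall_inP=> v /con_y.
  by rewrite (sym_connect_sym (pair_adj_sym _)); apply: connect_trans.
apply/forallP=> n; apply/forallP=> c; apply/implyP=> /andP[cyc uc].
have [xc|xc] := boolP (x \in val c).
  (* Rotated to begin at [x], the cycle has [y] as its second and as its last vertex; from three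
     vertices on this contradicts uniqueness. *)
  have [i p Ep] := rot_to xc; rewrite -(size_rot i) Ep.
  move: cyc uc; rewrite -(rot_cycle i) -(rot_uniq i) Ep /=.
  case: p {Ep} => [|z p] //; case/lastP: p => [|p w] //=.
  rewrite rcons_path last_rcons => /and3P[/adjx-> _].
  by rewrite pair_adj_sym => /adjx->; rewrite mem_rcons mem_head andbF.
have /and3P[_ _ /forallP/(_ n)/forallP/(_ c)/implyP] := st; apply.
rewrite /ucycleb uc andbT; apply: (sub_in_cycle (P := predC1 x)) cyc; last first.
  by apply/allP=> u uc'; apply: contraNneq xc => <-.
move=> u v /= u_x v_x; rewrite /pair_adj in_setU1 => /orP[/eqP/setP/(_ x)|//].
by rewrite !inE eqxx /= eq_sym (negbTE u_x) eq_sym (negbTE v_x).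
Qed.

Lemma mst_cost_le S F :
  spanning_tree e S F -> exists2 m, mst_cost e S = Some m & m <= tree_weight e F.
Proof.
move=> st; rewrite /mst_cost; case: pickP => [F0 st0|/(_ F)]; last by rewrite st.
by eexists => //; case: arg_minnP => // F1 _ /(_ F st).
Qed.

Lemma mst_cost_attained S m :
  mst_cost e S = Some m -> exists2 F, spanning_tree e S F & tree_weight e F = m.
Proof.
rewrite /mst_cost; case: pickP => // F0 st0 [<-].
by case: arg_minnP => // F1 st1 _; exists F1.
Qed.

Lemma mst_cost1 x : mst_cost e [set x] = Some 0.
Proof.
have [m -> ] := mst_cost_le (spanning_tree1 x).
by rewrite /tree_weight big_set0 leqn0 => /eqP->.
Qed.

Lemma mst_cost_leaf S x y d m :
  x \notin S -> y \in S -> connect e x y -> dist e x y <= d -> dist e y x <= d ->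
  mst_cost e S = Some m ->
  exists2 m', mst_cost e (x |: S) = Some m' & m' <= d + m.
Proof.
move=> xS yS cxy dxy dyx /mst_cost_attained[F st wF].
have [m' -> le_m] := mst_cost_le (spanning_tree_leaf st xS yS cxy).
exists m' => //; apply: leq_trans le_m _; rewrite /tree_weight big_setU1 /=.
  rewrite -wF leq_add2r; apply/bigmax_leqP=> u uP; apply/bigmax_leqP=> v vP.
  by move: uP vP; rewrite !inE => /orP[]/eqP-> /orP[]/eqP->; rewrite ?distxx.
apply/negP=> /(pair_adj_mem st)[]; by rewrite (negbTE xS).
Qed.

(** Induction on the size of the set: some [y] other than [x] is removed and then attached to [x] as
    a leaf. *)
Lemma mst_cost_finite S x :
  x \in S -> {in S, forall y, connect e x y} -> exists m, mst_cost e S = Some m.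
Proof.
have [n] := ubnP #|S|; elim: n S => // n IH S; rewrite ltnS => le_n xS con.
have [E|] := eqVneq (S :\ x) set0.
  by exists 0; rewrite -(setD1K xS) E setU0 mst_cost1.
case/set0Pn=> y; rewrite !inE => /andP[y_x yS].
have x_Sy : x \in S :\ y by rewrite !inE eq_sym y_x.
have [||//|m mE] := IH (S :\ y).
- by move: le_n; rewrite (cardsD1 y) yS.
- by [].
- by move=> z; rewrite !inE => /andP[_ /con].
have cyx : connect e y x by rewrite sym_connect_sym // con.
rewrite -(setD1K yS).
have y_Sy : y \notin S :\ y by rewrite !inE eqxx.
have [m' -> _] := mst_cost_leaf y_Sy x_Sy cyx (leq_maxl _ _) (leq_maxr _ _) mE.
by exists m'.
Qed.

End SpanningTrees.

(** * The low-level search *)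

HB.instance Definition _ (V : finType) := gen_eqMixin (astate V).

Section OpenSet.
Variable V : finType.
Implicit Types (s : astate V) (open closed : seq (astate V)).

Definition key s : {set V} * tis V := (visited s, current s).

Definition dominated (S : seq (astate V)) (x : {set V} * tis V) (g : nat) : Prop :=
  exists2 s, s \in S & key s = x /\ gval s <= g.

Lemma same_stateE s s' : same_state s s' = (key s == key s').
Proof. by []. Qed.

Lemma insert_open_mem closed open s s' :
  s' \in insert_open closed open s -> s' = s \/ s' \in open.
Proof.
rewrite /insert_open; case: ifP => _; first by auto.
case: ifP => _; last by move=> /predU1P.
by case/mapP=> s1 s1P ->; case: ifP; auto.
Qed.

Lemma insert_open_uniq closed open s :
  uniq (map key (open ++ closed)) ->
  uniq (map key (insert_open closed open s ++ closed)).
Proof.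
rewrite /insert_open; case: ifPn => // /hasPn nc; case: ifPn => [_|/hasPn no].
  suff E : map key [seq if same_state s s' && (gval s < gval s') then s else s' | s' <- open]
      = map key open by rewrite !map_cat E.
  rewrite -map_comp; apply: eq_map => s' /=.
  by case: ifP => //; rewrite same_stateE => /andP[/eqP].
move=> uniq_k /=; rewrite uniq_k andbT; apply/negP=> /mapP[s' + E].
by rewrite mem_cat => /orP[/no|/nc]; rewrite same_stateE E eqxx.
Qed.

Lemma insert_open_dominated closed open s x g :
  dominated open x g -> dominated (insert_open closed open s) x g.
Proof.
case=> s' s'P [<- le_g]; rewrite /insert_open.
case: ifP => _; first by exists s'.
case: ifP => _; last by exists s'; rewrite // inE s'P orbT.
set f := fun s' => _; exists (f s'); [exact: map_f | rewrite /f].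
case: ifP => //; rewrite same_stateE => /andP[/eqP-> lt_g]; split=> //.
exact: leq_trans (ltnW lt_g) le_g.
Qed.

Lemma insert_open_new closed open s :
  (exists2 s', s' \in closed & key s' = key s) \/
  dominated (insert_open closed open s) (key s) (gval s).
Proof.
rewrite /insert_open; case: ifPn => [/hasP[s' s'P]|_].
  by rewrite same_stateE => /eqP E; left; exists s'.
right; case: ifPn => [/hasP[s' s'P E]|_]; last by exists s; rewrite // mem_head.
set f := fun s' => _; exists (f s'); [exact: map_f | rewrite /f].
rewrite E /=; rewrite same_stateE in E; rewrite (eqP E).
by case: ltnP => // le_g; split=> //; rewrite (eqP E).
Qed.

Section Weight.
Variable B : nat.

(** [B] will bound the number of successors of a state. Each of them has visited one more vertex, so
    together they weigh less than the state that they replace. *)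
Definition state_weight s : nat := B.+1 ^ (#|V| - #|visited s|).

Lemma insert_open_weight closed open s :
  \sum_(s' <- insert_open closed open s) state_weight s' <=
  \sum_(s' <- open) state_weight s' + state_weight s.
Proof.
rewrite /insert_open; case: ifP => _; first exact: leq_addr.
case: ifP => _; last by rewrite big_cons addnC.
rewrite big_map (eq_bigr state_weight) ?leq_addr // => s' _.
by case: ifP => //; rewrite same_stateE /state_weight => /andP[/eqP[-> _]].
Qed.

Lemma insert_all_weight closed open (succs : seq (astate V)) :
  \sum_(s' <- foldl (insert_open closed) open succs) state_weight s' <=
  \sum_(s' <- open) state_weight s' + \sum_(s' <- succs) state_weight s'.
Proof.
elim: succs open => [|s succs IH] open /=; first by rewrite big_nil addn0.
apply: leq_trans (IH _) _; rewrite big_cons addnA leq_add2r.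
exact: insert_open_weight.
Qed.

End Weight.

Lemma insert_all_mem closed open succs s :
  s \in foldl (insert_open closed) open succs -> s \in open \/ s \in succs.
Proof.
elim: succs open => [|s1 succs IH] open /=; first by auto.
rewrite inE; case/IH => [/insert_open_mem[->|]|->]; rewrite ?eqxx ?orbT; auto.
Qed.

Lemma insert_all_uniq closed open succs :
  uniq (map key (open ++ closed)) ->
  uniq (map key (foldl (insert_open closed) open succs ++ closed)).
Proof. by elim: succs open => //= s1 succs IH open /(insert_open_uniq s1)/IH. Qed.

Lemma insert_all_dominated closed open succs x g :
  dominated open x g -> dominated (foldl (insert_open closed) open succs) x g.
Proof.
elim: succs open => //= s1 succs IH open /(insert_open_dominated closed s1).
exact: IH.
Qed.

Lemma insert_all_new closed open succs s :
  s \in succs ->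
  (exists2 s', s' \in closed & key s' = key s) \/
  dominated (foldl (insert_open closed) open succs) (key s) (gval s).
Proof.
elim: succs open => //= s1 succs IH open; rewrite inE => /predU1P[->|/IH//].
have [|dom] := insert_open_new closed open s1; first by left.
by right; apply: insert_all_dominated.
Qed.

End OpenSet.

Section LowLevel.
Variables (V : finType) (k : nat) (I : instance V k).
Variables (cs : seq (constraint V k)) (a : 'I_k).

Local Notation walk := (walk I cs a).
Local Notation gsi := (goal_safe_itvs I cs a).

Definition respects (p : seq V) : Prop :=
  forall t, safe cs a (position I a p t) t &&
    move_allowed cs a (position I a p t) (position I a p t.+1) t.

(** Deleting the waits leaves a path of the graph, which can be reversed. Both directions are needed
    because [tree_weight] takes the larger of the two distances of a pair. *)
Lemma walk_dist t u w :
  walk t u w -> dist (edge I) u (last u w) <= size w /\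
    dist (edge I) (last u w) u <= size w /\ connect (edge I) u (last u w).
Proof.
move=> ww; suff [p1 [p2 [P1 E1 s1 P2 [E2 s2]]]] : exists p1 p2 : seq V,
    [/\ path (edge I) u p1, last u p1 = last u w, size p1 <= size w,
      path (edge I) (last u w) p2 & last (last u w) p2 = u /\ size p2 <= size w].
  split; first exact: leq_trans (dist_le P1 E1) s1.
  split; first exact: leq_trans (dist_le P2 E2) s2.
  by apply/connectP; exists p1.
elim: w t u ww => [|v w IH] t u /=; first by exists [::], [::].
case/andP=> /and4P[adj _ _ _] /IH[p1 [p2 [P1 E1 s1 P2 [E2 s2]]]].
case: eqVneq adj => [-> _|_ /= uv].
  by exists p1, p2; rewrite P1 E1 P2 E2 !leqW.
exists (v :: p1), (rcons p2 u); rewrite /= uv rcons_path P2 E2 last_rcons.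
by rewrite edge_sym uv size_rcons.
Qed.

Lemma walk_nth x0 t u w i :
  walk t u w -> i < size w ->
  transition I cs a (t + i) (nth x0 (u :: w) i) (nth x0 (u :: w) i.+1).
Proof.
elim: w t u i => // v w IH t u [|i] /= /andP[tr ww]; first by rewrite addn0.
by rewrite ltnS addnS -addSn; apply: IH.
Qed.

Definition initial_itv : tis V :=
  head ((0, None), start I a) (safe_itvs cs a (start I a)).

Lemma initial_itv_start : initial_itv.2 = start I a.
Proof.
rewrite /initial_itv; case E: (safe_itvs _ _ _) => [|q s] //=.
by apply: (@mem_safe_itvs _ _ cs a); rewrite E mem_head.
Qed.

Lemma initial_itv_safe :
  safe cs a (start I a) 0 ->
  initial_itv \in safe_itvs cs a (start I a) /\ in_itv initial_itv.1 0.
Proof.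
move=> s0; have [_ [/mapP[J JP [->]] J0]] := safe_itvs_cover s0.
rewrite /initial_itv /safe_itvs.
have := head_maximal_itvs (@safe_const _ _ cs a (start I a)) (0, None) JP J0.
case: (maximal_itvs _ _) JP => //= J' s _ ->; by rewrite mem_head.
Qed.

Lemma last_safe_itvs q0 v :
  last q0 (safe_itvs cs a v) \in safe_itvs cs a v /\
  (last q0 (safe_itvs cs a v)).1.2 = None.
Proof.
have [] := last_maximal_itvs (@safe_const _ _ cs a v) (0, None)
  (safe_horizon a v (leqnn _)).
rewrite /safe_itvs; case: (maximal_itvs _ _) => //= J s JP J2.
by rewrite (last_map (fun J => (J, v))) J2 (map_f (fun J => (J, v)) JP).
Qed.

(** All ways of visiting the goals, along arbitrary instead of shortest walks:
    the search is compared with these. *)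
Inductive reach : {set V} -> tis V -> nat -> Prop :=
| reach_init : reach set0 initial_itv 0
| reach_next L p g q w :
    reach L p g -> q \in gsi ->
    transition_allowed I cs a (AState L p g None) q ->
    walk g p.2 w -> last p.2 w = q.2 -> in_itv q.1 (g + size w) ->
    reach (q.2 |: L) q (g + size w).

Section Forest.
Variable F : forest V.
Hypotheses (F_inv : forest_inv I cs a F) (F_complete : forest_complete F).

Inductive generated : astate V -> Prop :=
| generated_init : generated (astate_init I cs a)
| generated_next s q d :
    generated s -> q \in gsi -> transition_allowed I cs a s q ->
    query_cost F q (gval s) (current s).2 = Some d ->
    generated (AState (q.2 |: visited s) q (gval s + d) (Some s)).

Lemma query_cost_sound q t v d :
  query_cost F q t v = Some d -> exists n, [/\ query F q t v = Some n,
    walk t v (node_path n), size (node_path n) = d,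
    last v (node_path n) = q.2 & in_itv q.1 (t + d) /\ safe cs a v t].
Proof.
rewrite /query_cost; case E: (query F q t v) => [n|] // nd.
by have [? ? ? ? ?] := query_sound F_inv F_complete E nd; exists n.
Qed.

Lemma generated_reach s :
  generated s -> reach (visited s) (current s) (gval s).
Proof.
elim=> [|{}s q d _ IH qP al /query_cost_sound[n [_ w <- E [tq _]]]] /=.
  exact: reach_init.
by apply: reach_next IH qP al w E tq.
Qed.

Lemma successorsP s s' :
  reflect (exists q d, [/\ q \in gsi, transition_allowed I cs a s q,
      query_cost F q (gval s) (current s).2 = Some d &
      s' = AState (q.2 |: visited s) q (gval s + d) (Some s)])
    (s' \in successors I cs a F s).
Proof.
rewrite mem_pmap; apply: (iffP mapP) => [[q]|[q [d [qP al qd ->]]]].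
  rewrite mem_filter => /andP[al qP].
  case qd: (query_cost _ _ _ _) => [d|] //= [->].
  by exists q, d.
by exists q; rewrite ?mem_filter ?al // qd.
Qed.

Lemma build_path_rcons t v qs q :
  build_path F t v (rcons qs q) =
  build_path F t v qs ++
    (if query F q (t + size (build_path F t v qs)) (last v (map snd qs)) is Some n
     then node_path n else [::]).
Proof.
elim: qs t v => [|q' qs IH] t v /=; first by rewrite addn0 cats0.
by rewrite IH catA size_cat addnA.
Qed.

(** The length and the end of the path built so far agree with the g-value and the current vertex,
    so [build_path] repeats exactly the queries made during the search. *)
Lemma generated_path s :
  generated s ->
  let p := build_path F 0 (start I a) (visiting_order s) in
  [/\ last (start I a) (map snd (visiting_order s)) = (current s).2,
      walk 0 (start I a) p, size p = gval s,
      last (start I a) p = (current s).2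
    & {subset visited s <= start I a :: p}].
Proof.
elim=> [|{}s q d gs [lastE w sz E sub] qP al qd] /=.
  by split=> //; rewrite ?initial_itv_start // => v; rewrite inE.
have [n [nE wn sn En _]] := query_cost_sound qd.
rewrite build_path_rcons map_rcons last_rcons add0n lastE sz nE.
rewrite walk_cat w add0n sz E wn size_cat sz sn last_cat E En; split=> //.
move=> v; rewrite in_setU1 => /orP[/eqP->|/sub vP].
  set p := build_path _ _ _ _ in E *.
  by have := mem_last (start I a) (p ++ node_path n); rewrite last_cat E En.
by move: vP; rewrite !inE mem_cat orbA => ->.
Qed.

End Forest.
End LowLevel.

Section Search.
Variables (V : finType) (k : nat) (I : instance V k).
Variables (cs : seq (constraint V k)) (a : 'I_k) (F : forest V).
Hypotheses (F_inv : forest_inv I cs a F) (F_complete : forest_complete F).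

Local Notation walk := (walk I cs a).
Local Notation gsi := (goal_safe_itvs I cs a).
Local Notation reach := (reach I cs a).
Local Notation expand O C s :=
  (foldl (insert_open (s :: C)) O (successors I cs a F s)).

Definition search_inv (O C : seq (astate V)) : Prop :=
  {in O ++ C, forall s, generated I cs a F s} /\
  {in C, forall s, ~~ (goals I a \subset visited s)}.

Lemma search_init_inv : search_inv [:: astate_init I cs a] [::].
Proof. by split=> // s; rewrite inE => /eqP->; apply: generated_init. Qed.

Lemma search_expand_inv O1 O2 C s :
  search_inv (O1 ++ s :: O2) C -> ~~ (goals I a \subset visited s) ->
  search_inv (expand (O1 ++ O2) C s) (s :: C).
Proof.
case=> gen nfin sP; split; last first.
  by move=> s'; rewrite inE => /predU1P[->//|/nfin].
have gs : generated I cs a F s by apply: gen; rewrite !mem_cat mem_head orbT.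
move=> s'; rewrite mem_cat => /orP[/insert_all_mem[s'P|/successorsP]|].
- by apply: gen; move: s'P; rewrite !mem_cat inE => /orP[]->; rewrite ?orbT.
- by case=> q [d [qP al qd ->]]; apply: generated_next.
by rewrite inE => /predU1P[-> //|s'P]; apply: gen; rewrite mem_cat s'P orbT.
Qed.

Definition search_measure (O : seq (astate V)) : nat :=
  \sum_(s <- O) state_weight (size gsi) s.

Lemma search_expand_measure O1 O2 C s :
  search_measure (expand (O1 ++ O2) C s) < search_measure (O1 ++ s :: O2).
Proof.
apply: leq_ltn_trans (insert_all_weight _ _ _ _) _.
rewrite /search_measure !big_cat big_cons /= addnCA [X in _ < X]addnC ltn_add2l.
set B := size gsi.
(* When every vertex is visited the exponent cannot drop further, but then there are no
   successors. *)
have [vT|lt_s] := leqP #|V| #|visited s|.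
  rewrite big_seq big1 ?expn_gt0 // => s' /successorsP[q [d [_ /andP[+ _] _ _]]].
  have -> : visited s = setT by apply/eqP; rewrite eqEcard subsetT cardsT.
  by rewrite inE.
have wE s' : s' \in successors I cs a F s ->
    state_weight B s' = B.+1 ^ (#|V| - #|visited s|).-1.
  by case/successorsP=> q [d [_ /andP[nq _] _ ->]]; rewrite /state_weight cardsU1 nq subnS.
rewrite big_seq (eq_bigr _ wE) -big_seq big_const_seq count_predT iter_addn_0.
rewrite /state_weight; have -> : #|V| - #|visited s| = (#|V| - #|visited s|).-1.+1.
  by rewrite prednK // subn_gt0.
rewrite expnS mulnC ltn_pmul2r ?expn_gt0 // ltnS.
by rewrite size_pmap; apply: leq_trans (count_size _ _) _; rewrite size_filter count_size.
Qed.

(** * Optimality of the closed states *)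

Section Optimality.
Hypothesis no_wait_constraint : forall v t, move_allowed cs a v v t.
Hypothesis start_safe : safe cs a (start I a) 0.
Hypothesis goals_connected : {in goals I a, forall g, connect (edge I) (start I a) g}.

Local Notation remaining L p := (p.2 |: (goals I a :\: L)).

Lemma goal_safe_itv q :
  q \in gsi -> q.2 \in goals I a /\ q \in safe_itvs cs a q.2.
Proof. by rewrite mem_goal_safe_itvs => /andP. Qed.

Lemma reach_itv L p g :
  reach L p g -> [/\ in_itv p.1 g, p \in safe_itvs cs a p.2
    & connect (edge I) (start I a) p.2].
Proof.
case=> [|{}L {}p {}g q w rL /goal_safe_itv[qG qS] _ _ _ tq].
  have [p0 t0] := initial_itv_safe start_safe.
  by rewrite initial_itv_start connect0.
by split=> //; apply: goals_connected.
Qed.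

Lemma remaining_finite L p g :
  reach L p g -> exists m, mst_cost (edge I) (remaining L p) = Some m.
Proof.
case/reach_itv=> _ _ sp; apply: (mst_cost_finite (@edge_sym _ _ I) (setU11 p.2 _)) => v.
rewrite !inE => /orP[/eqP->|/andP[_ /goals_connected]]; first exact: connect0.
by apply: connect_trans; rewrite (sym_connect_sym (@edge_sym _ _ I)).
Qed.

(** Consistency of the heuristic. After the transition the set to be spanned is [goals I a :\: L];
    before it, the set differs at most by the vertex of [p], which can be attached to that of [q] at
    a distance of at most [size w]. *)
Lemma remaining_consistent (L : {set V}) (p q : tis V) t w m :
  walk t p.2 w -> last p.2 w = q.2 -> q.2 \in goals I a -> q.2 \notin L ->
  mst_cost (edge I) (remaining (q.2 |: L) q) = Some m ->
  exists2 m', mst_cost (edge I) (remaining L p) = Some m' & m' <= size w + m.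
Proof.
move=> ww E qG qL; have qR : q.2 \in goals I a :\: L by rewrite inE qL.
have -> : remaining (q.2 |: L) q = goals I a :\: L.
  by rewrite [q.2 |: L]setUC -setDDl setD1K.
have [pR mE|pR mE] := boolP (p.2 \in goals I a :\: L).
  have -> : remaining L p = goals I a :\: L by apply/setUidPr; rewrite sub1set.
  by exists m; rewrite // leq_addl.
have [d1 [d2 cpq]] := walk_dist ww; rewrite E in d1 d2 cpq.
exact: mst_cost_leaf pR qR cpq d1 d2 mE.
Qed.

Lemma walk_wait t v j :
  (forall t', t <= t' <= t + j -> safe cs a v t') -> walk t v (nseq j v).
Proof.
elim: j t => //= j IH t vS; rewrite /transition eqxx no_wait_constraint /=.
have vSj t' : t.+1 <= t' <= t.+1 + j -> safe cs a v t'.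
  by move=> t'P; apply: vS; move: t'P; clear; lia.
by rewrite IH // !vS //; clear; lia.
Qed.

(** The A* invariant relative to all plans in [reach]. The second and third clauses let [frontier]
    follow a plan through closed states until it meets an open one. *)
Definition optimal_inv (O C : seq (astate V)) : Prop :=
  [/\ uniq (map (@key V) (O ++ C)),
      dominated (O ++ C) (set0, initial_itv I cs a) 0,
      forall s q d, s \in C -> q \in gsi -> transition_allowed I cs a s q ->
        query_cost F q (gval s) (current s).2 = Some d ->
        dominated (O ++ C) (q.2 |: visited s, q) (gval s + d)
    & forall s g, s \in C -> reach (visited s) (current s) g -> gval s <= g].

Lemma optimal_init_inv : optimal_inv [:: astate_init I cs a] [::].
Proof. by split=> //; exists (astate_init I cs a); rewrite ?inE. Qed.

Lemma dominated_cat (S1 S2 : seq (astate V)) x g :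
  dominated (S1 ++ S2) x g <-> dominated S1 x g \/ dominated S2 x g.
Proof.
split=> [[s]|[[s sS sx]|[s sS sx]]].
- by rewrite mem_cat => /orP[]; [left|right]; exists s.
- by exists s; rewrite // mem_cat sS.
by exists s; rewrite // mem_cat sS orbT.
Qed.

Lemma dominated_fval S L p g m :
  dominated S (L, p) g -> mst_cost (edge I) (remaining L p) = Some m ->
  exists2 s, s \in S & ext_le (fval I a s) (Some (g + m)).
Proof.
case=> s sS [[<- <-] le_g] mE; exists s => //.
by rewrite /fval mE /= leq_add2r.
Qed.

(** A closed state reached earlier than [g] can wait inside its safe interval
    until [g] and then follow the given walk; this is where constraints on waiting
    must be excluded. *)
Lemma frontier O C L p g :
  search_inv O C -> optimal_inv O C -> reach L p g ->
  dominated C (L, p) g \/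
  exists2 m, mst_cost (edge I) (remaining L p) = Some m &
    exists2 s, s \in O & ext_le (fval I a s) (Some (g + m)).
Proof.
case=> gen _ [_ init succ opt]; elim=> [|{}L {}p {}g q w rL IH qG al ww E tq].
  have [m mE] := remaining_finite (reach_init I cs a).
  case/dominated_cat: init => init; last by left.
  by right; exists m => //; apply: dominated_fval init mE.
have rq := reach_next rL qG al ww E tq; have [m mE] := remaining_finite rq.
have [qgoal _] := goal_safe_itv qG; have /andP[/= qL _] := al.
have [tp pS _] := reach_itv rL.
case: IH => [[s sC [[vs cs'] le_g]]|[m' mE' [s sO fs]]]; last first.
  (* The plan met an open state earlier; by consistency the bound does not decrease along the new
     walk. *)
  right; exists m => //; exists s => //.
  have [m1 ] := remaining_consistent ww E qgoal qL mE.
  rewrite mE' => -[<-] le_m'; apply: ext_le_trans fs _ => /=.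
  by rewrite -addnA leq_add2l.
have rs : reach (visited s) (current s) (gval s).
  by apply: generated_reach (gen s _) => //; rewrite mem_cat sC orbT.
have [ts _ _] := reach_itv rs; rewrite cs' in ts.
have pSafe t : gval s <= t <= g -> safe cs a p.2 t.
  move=> tP; apply: safe_itvs_safe pS _; move: tp ts tP; rewrite /in_itv.
  by clear; case: p.1 => lo [h|] /=; lia.
have wait : walk (gval s) p.2 (nseq (g - gval s) p.2).
  by apply: walk_wait => t tP; apply: pSafe; move: tP le_g; clear; lia.
have last_nseq j : last p.2 (nseq j p.2) = p.2 by elim: j.
have [||||c qc le_c] := @query_optimal _ _ _ _ _ _ F_inv F_complete q (gval s) p.2
    (nseq (g - gval s) p.2 ++ w) qG.
- by apply: pSafe; rewrite leqnn.
- by rewrite walk_cat wait size_nseq last_nseq subnKC.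
- by rewrite last_cat last_nseq.
- by rewrite size_cat size_nseq addnA subnKC.
have : dominated (O ++ C) (q.2 |: L, q) (g + size w).
  rewrite -vs; have [||s' s'P [ks' le_s']] := succ s q c sC qG.
  - by rewrite /transition_allowed vs.
  - by rewrite cs'.
  exists s' => //; split=> //; apply: leq_trans le_s' _.
  by move: le_c le_g; rewrite size_cat size_nseq; clear; lia.
case/dominated_cat=> dom; last by left.
by right; exists m => //; apply: dominated_fval dom mE.
Qed.

(** A plan reaching the key of [s] at time [g] cannot end in the old closed set, since keys are
    distinct. So [frontier] gives an open state with f-value at most [g] plus the heuristic of [s],
    and minimality of [s] yields [gval s <= g]. *)
Lemma optimal_expand_inv O1 O2 C s :
  search_inv (O1 ++ s :: O2) C -> optimal_inv (O1 ++ s :: O2) C ->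
  all (fun s' => ext_le (fval I a s) (fval I a s')) (O1 ++ O2) ->
  optimal_inv (expand (O1 ++ O2) C s) (s :: C).
Proof.
move=> sinv oinv min_s; have [gen _] := sinv; have [uniq_k init succ opt] := oinv.
have gs : generated I cs a F s by apply: gen; rewrite !mem_cat mem_head orbT.
have perm_s : perm_eq ((O1 ++ O2) ++ s :: C) ((O1 ++ s :: O2) ++ C).
  apply/permP=> P; rewrite !count_cat /= !addnA; congr (_ + _); exact: addnAC.
have uniq_s : uniq (map (@key V) ((O1 ++ O2) ++ s :: C)).
  by rewrite (perm_uniq (perm_map _ perm_s)).
have opt_s g : reach (visited s) (current s) g -> gval s <= g.
  move=> rs; case: (frontier sinv oinv rs) => [[s' s'C [ks _]]|[m mE [s' s'O fs']]].
    move: uniq_s; rewrite map_cat cat_uniq /= => /and4P[_ _ /negP nk _]; case: nk.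
    by rewrite -[(visited s, current s)]/(key s) in ks; rewrite -ks map_f.
  have : ext_le (fval I a s) (Some (g + m)).
    apply: ext_le_trans fs'; move: s'O; rewrite mem_cat inE orbCA -mem_cat.
    by case/predU1P=> [->|/(allP min_s)//]; apply: ext_le_refl.
  by rewrite /fval mE /= leq_add2r.
have opt' s' g : s' \in s :: C -> reach (visited s') (current s') g -> gval s' <= g.
  by rewrite inE => /predU1P[-> /opt_s//|/opt]; apply.
have keep x g : dominated ((O1 ++ s :: O2) ++ C) x g ->
    dominated (expand (O1 ++ O2) C s ++ s :: C) x g.
  case=> s'; rewrite -(perm_mem perm_s) => s'P kx.
  have /dominated_cat[dom|dom] : dominated ((O1 ++ O2) ++ s :: C) x g by exists s'.
    by apply/dominated_cat; left; apply: insert_all_dominated.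
  by apply/dominated_cat; right.
split=> //.
- exact: insert_all_uniq.
- exact: keep.
move=> s' q d; rewrite inE => /predU1P[->|s'C] qG al qd; last exact/keep/succ.
pose sq := AState (q.2 |: visited s) q (gval s + d) (Some s).
have sqP : sq \in successors I cs a F s by apply/successorsP; exists q, d.
have gsq : generated I cs a F sq by apply: generated_next.
apply/dominated_cat.
(* If the key of [sq] is closed, the closed g-value is optimal, and the g-value of [sq] is attained
   by a plan in [reach]. *)
case: (insert_all_new (s :: C) (O1 ++ O2) sqP) => [[s0 s0P ks0]|]; last by left.
right; exists s0 => //; split=> //; apply: (opt' s0 _ s0P).
by have := generated_reach F_inv F_complete gsq; case: ks0 => -> ->.
Qed.

End Optimality.
End Search.

(** * Total correctness of the low-level solver *)

Section LowSolver.
Variables (V : finType) (k : nat) (I : instance V k).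
Variables (cs : seq (constraint V k)) (a : 'I_k).
Hypothesis no_wait_constraint : forall v t, move_allowed cs a v v t.

Local Notation gsi := (goal_safe_itvs I cs a).
Local Notation x0 := (start I a).

Lemma position_size p t : size p <= t -> position I a p t = last x0 p.
Proof.
rewrite /position leq_eqVlt => /predU1P[<-|lt_t]; last by rewrite nth_default.
by rewrite nth_last.
Qed.

Lemma position_nth p t : t <= size p -> position I a p t = nth x0 (x0 :: p) t.
Proof. by move=> le_t; apply: set_nth_default. Qed.

Lemma path_nth p t :
  path (fun u v => (u == v) || edge I u v) x0 p -> t < size p ->
  (nth x0 (x0 :: p) t == nth x0 (x0 :: p) t.+1)
    || edge I (nth x0 (x0 :: p) t) (nth x0 (x0 :: p) t.+1).
Proof. by move=> /(pathP x0); apply. Qed.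

Lemma walk_path u t w :
  walk I cs a t u w -> path (fun u v => (u == v) || edge I u v) u w.
Proof. by elim: w t u => //= v w IH t u /andP[/and4P[-> _ _ _] /IH]. Qed.

(** The final transition enters the latest safe interval of the last goal. That interval is
    unbounded, so the agent may stay there forever. *)
Lemma goal_path_sound F s :
  forest_inv I cs a F -> forest_complete F -> generated I cs a F s ->
  goals I a \subset visited s ->
  let p := build_path F 0 x0 (visiting_order s) in
  is_agent_path I a p /\ respects I cs a p.
Proof.
move=> F_inv F_complete gs fin; have [_ w sz E sub] := generated_path F_inv F_complete gs.
set p := build_path _ _ _ _ in w sz E sub *.
case: gs fin @p w sz E sub => [|{}s q d gs qP al qd].
  by rewrite subset0 (negbTE (goals_neq0 _ _)).
move=> fin p w sz E sub; have [qG qS] := goal_safe_itv qP.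
have [n [_ _ _ _ [tq _]]] := query_cost_sound F_inv F_complete qd.
rewrite /= in fin sz E sub tq; case/andP: al => nq /implyP last_q.
have qE : q = last q (safe_itvs cs a q.2).
  apply/eqP/last_q; rewrite eqEsubset sub1set in_setD nq qG !andbT.
  apply/subsetP=> g; rewrite !inE => /andP[ng gG].
  by have := subsetP fin g gG; rewrite !inE (negbTE ng) orbF.
have qinf : q.1.2 = None by rewrite qE; case: (last_safe_itvs cs a q q.2).
have safe_after t : size p <= t -> safe cs a q.2 t.
  move=> le_t; apply: safe_itvs_safe qS _; move: tq; rewrite /in_itv qinf -sz.
  by case/andP=> /leq_trans-> //.
split.
  apply/and3P; split; [exact: walk_path w | | by rewrite E].
  by apply/forall_inP=> g gG; apply: sub; apply: (subsetP fin).
move=> t; case: (ltnP t (size p)) => [lt_t|le_t]; last first.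
  by rewrite !position_size ?leqW // E no_wait_constraint safe_after.
rewrite !position_nth ?(ltnW lt_t) //.
by have /and4P[_ -> _ ->] := walk_nth x0 w lt_t.
Qed.

Section Feasible.
Variable p : seq V.
Hypotheses (p_path : is_agent_path I a p) (p_resp : respects I cs a p).

Lemma respects_start_safe : safe cs a x0 0.
Proof. by have /andP[] := p_resp 0. Qed.

Lemma position_transition t :
  transition I cs a t (position I a p t) (position I a p t.+1).
Proof.
have /andP[s0 mv] := p_resp t; have /andP[s1 _] := p_resp t.+1.
apply/and4P; split=> //; have /and3P[pp _ _] := p_path.
case: (ltnP t (size p)) => [lt_t|le_t]; last by rewrite !position_size ?leqW ?eqxx.
by rewrite !position_nth ?(ltnW lt_t) //; apply: path_nth.
Qed.

Lemma position_connect t : connect (edge I) x0 (position I a p t).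
Proof.
elim: t => [|t IH]; first exact: connect0.
apply: connect_trans IH _; have /and4P[+ _ _ _] := position_transition t.
by case/orP=> [/eqP->|/connect1].
Qed.

Lemma goal_position g : g \in goals I a -> exists2 t, t <= size p & position I a p t = g.
Proof.
have /and3P[_ /forall_inP vis _] := p_path; move=> /vis gp.
exists (index g (x0 :: p)); first by rewrite -ltnS -[(size p).+1]/(size (x0 :: p)) index_mem.
by rewrite /position nth_index.
Qed.

Lemma feasible_goals_connected : {in goals I a, forall g, connect (edge I) x0 g}.
Proof. by move=> g /goal_position[t _ <-]; apply: position_connect. Qed.

(** The given path is followed, with a transition at each newly met goal except the final vertex.
    That one is held back: the search must enter it last, in its latest interval, and while it is
    unvisited the restriction on the last goal does not apply to the others. [w] is the walk since
    the last transition. *)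
Lemma reach_prefix t :
  exists L q g w,
    [/\ reach I cs a L q g, walk I cs a g q.2 w, g + size w = t,
        last q.2 w = position I a p t &
        last x0 p \notin L /\ forall j, j <= t -> position I a p j \in goals I a ->
          position I a p j != last x0 p -> position I a p j \in L].
Proof.
have /and3P[_ _ eG] := p_path; set e := last x0 p in eG *.
have visit L q g w v : reach I cs a L q g -> walk I cs a g q.2 w ->
    last q.2 w = v -> v \in goals I a -> v != e -> v \notin L -> e \notin L ->
    safe cs a v (g + size w) ->
    exists q', [/\ reach I cs a (v |: L) q' (g + size w), q'.2 = v & e \notin v |: L].
  move=> rL ww E vG v_e vL eL vS; have [J [JS tJ]] := safe_itvs_cover vS.
  exists (J, v); split=> //; last by rewrite !inE negb_or eq_sym v_e.
  apply: (reach_next (q := (J, v))) rL _ _ ww E tJ; first by rewrite mem_goal_safe_itvs vG.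
  apply/andP; split=> //; apply/implyP=> /eqP/setP/(_ e).
  by rewrite !inE eL eG eq_sym (negbTE v_e).
have extend L q g w t' : 
    reach I cs a L q g -> walk I cs a g q.2 w -> g + size w = t' ->
    last q.2 w = position I a p t' -> e \notin L ->
    (forall j, j < t' -> position I a p j \in goals I a ->
       position I a p j != e -> position I a p j \in L) ->
  exists L q g w,
    [/\ reach I cs a L q g, walk I cs a g q.2 w, g + size w = t',
        last q.2 w = position I a p t' &
        e \notin L /\ forall j, j <= t' -> position I a p j \in goals I a ->
          position I a p j != e -> position I a p j \in L].
  move=> rL ww sz E eL vis.
  (* A new goal turns the current walk into a transition; otherwise the walk goes on. *)
  have [|nvis] := boolP [&& position I a p t' \in goals I a, position I a p t' != e
      & position I a p t' \notin L].
    case/and3P=> vG v_e vL.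
    have [|q' [rq' q'2 eL']] := visit _ _ _ _ _ rL ww E vG v_e vL eL.
      by rewrite sz; case/andP: (p_resp t').
    rewrite sz in rq'; exists (position I a p t' |: L), q', t', [::].
    rewrite addn0 q'2; split=> //; split=> // j.
    rewrite leq_eqVlt => /predU1P[->|lt_j]; first by rewrite setU11.
    by move=> jG j_e; rewrite inE vis ?orbT.
  exists L, q, g, w; split=> //; split=> // j.
  rewrite leq_eqVlt => /predU1P[->|]; last exact: vis.
  by move=> jG j_e; move: nvis; rewrite jG j_e negbK.
elim: t => [|t [L [q [g [w [rL ww sz E [eL vis]]]]]]].
  apply: extend (reach_init I cs a) _ _ _ _ _ => //; last by rewrite inE.
  - exact: (isT : walk I cs a 0 _ [::]).
  - by [].
  by rewrite /= initial_itv_start.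
apply: (extend L q g (rcons w (position I a p t.+1))) => //.
- by rewrite -cats1 walk_cat ww sz E /= position_transition.
- by rewrite size_rcons addnS sz.
by rewrite last_rcons.
Qed.

Lemma reach_goals :
  exists L q, [/\ reach I cs a L q (size p), goals I a \subset L & q.2 \in L].
Proof.
have [L [q [g [w [rL ww sz E [eL vis]]]]]] := reach_prefix (size p).
have /and3P[_ _ eG] := p_path; set e := last x0 p in eG eL vis.
have RE : goals I a :\: L = [set e].
  apply/setP=> v; rewrite !inE; apply/andP/eqP => [[vL vG]|-> //].
  have [t le_t tv] := goal_position vG; apply: contraNeq vL => v_e.
  by rewrite -tv; apply: vis; rewrite ?tv.
have [qeS qe_inf] := last_safe_itvs cs a q e.
set qe := last q (safe_itvs cs a e) in qeS qe_inf.
have qe2 : qe.2 = e by apply: mem_safe_itvs qeS.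
have after t : size p <= t -> safe cs a e t.
  by move=> le_t; rewrite /e -(position_size le_t); case/andP: (p_resp t).
have [J [JS tJ]] := safe_itvs_cover (after _ (leqnn _)).
have J2 : J.2 = None.
  case: J JS tJ => lo [h|] //= /mapP[J' JP [E']] tJ; have [_] := 
    maximal_itvs_hi (@safe_const _ _ cs a e) JP (esym (congr1 snd E')).
  by rewrite after //; move: tJ; rewrite /in_itv /=; lia.
(* Two unbounded safe intervals at [e] have a late time in common and are therefore equal. *)
have tqe : in_itv qe.1 (size p).
  have <- : (J, e) = qe; last by [].
  have tm : in_itv J (maxn J.1 qe.1.1) by rewrite /in_itv J2 leq_maxl.
  apply: (safe_itvs_inj (q := (J, e)) (q' := qe) JS _ _ tm) => //; first by rewrite qe2.
  by rewrite /in_itv qe_inf leq_maxr.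
have := reach_next rL (q := qe) _ _ ww _ _; rewrite sz => rq.
exists (qe.2 |: L), qe; split; last exact: setU11.
  apply: rq => //; first by rewrite mem_goal_safe_itvs qe2 eG.
    apply/andP; rewrite qe2; split=> //=; apply/implyP=> _.
    apply/eqP; rewrite /qe; case: (safe_itvs cs a e) qeS => //.
  by rewrite qe2 E position_size.
apply/subsetP=> v vG; rewrite qe2 !inE; move/setP/(_ v): RE; rewrite !inE vG andbT.
by case: (v == e) => //= /negbFE.
Qed.

End Feasible.

Definition low_spec (r : option (seq V)) : Prop :=
  (forall p, r = Some p -> is_agent_path I a p /\ respects I cs a p) /\
  (forall p, is_agent_path I a p -> respects I cs a p ->
     exists2 p', r = Some p' & size p' <= size p).

Definition low_result (l : low_state V) : Prop :=
  exists2 r, l = LDone r & low_spec r.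

Lemma low_search_ensures F :
  forest_inv I cs a F -> forest_complete F ->
  ensures (low_step I cs a) low_result (LSearch F [:: astate_init I cs a] [::]).
Proof.
move=> F_inv F_complete.
(* The optimality invariant relies on a safe start and reachable goals, both of which come from a
   feasible path. Termination and soundness are proved without one. *)
pose feasible := exists2 p, is_agent_path I a p & respects I cs a p.
pose Inv l := if l is LSearch F' open C then
  [/\ F' = F, search_inv I cs a F open C & feasible -> optimal_inv I cs a F open C] else False.
pose mu l := if l is LSearch _ open _ then search_measure I cs a open else 0.
have found O C p : is_agent_path I a p -> respects I cs a p ->
    search_inv I cs a F O C -> optimal_inv I cs a F O C ->
    exists2 s, s \in O & ext_le (fval I a s) (Some (size p)).
  move=> pP pR sinv oinv; have [L [q [rL sub qL]]] := reach_goals pP pR.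
  (* A state with all goals visited is never closed, so the frontier is open. The set left to span
     is a single vertex, so the heuristic adds nothing. *)
  have [[s sC [[sL _] _]]|[m mE [s sO fs]]] := frontier F_inv F_complete no_wait_constraint
    (respects_start_safe pR) (feasible_goals_connected pP pR) sinv oinv rL.
    by have [_ /(_ s sC)] := sinv; rewrite sL sub.
  exists s => //; move: mE fs; have -> : goals I a :\: L = set0.
    by apply/eqP; rewrite setD_eq0.
  by rewrite setU0 mst_cost1 => -[<-]; rewrite addn0.
apply: (@ensures_measure _ _ _ Inv mu); last first.
- split=> //; first exact: search_init_inv.
  by case=> p pP pR; apply: optimal_init_inv.
- case=> // F' O C [-> sinv _] fin; exfalso.
  have [/nilP EO|] := boolP (nilp O).
    by rewrite EO in fin; apply: fin (low_fail _ _ _ _ _).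
  move/(ext_argmin (fval I a))=> [O1 [s [O2 [EO min_s]]]]; rewrite EO in fin.
  have [g|ng] := boolP (goals I a \subset visited s).
    by apply: fin; apply: low_goal.
  by apply: fin; apply: low_expand.
move=> [F0|F' O C|r] l' // [EF sinv oinv] st.
have done_ensures r : low_spec r -> ensures (low_step I cs a) low_result (LDone r).
  by move=> rP; constructor=> [l'' st'|_]; [inversion st' | exists r].
subst F'.
inversion st as [|F1 comp|F1 C1|F1 O1 O2 C1 s min_s fin|F1 O1 O2 C1 s min_s nfin]; subst.
- right; apply: done_ensures; split=> // p pP pR.
  have fe : feasible by exists p.
  by have [] := found _ _ _ pP pR sinv (oinv fe).
- have gs : generated I cs a F s.
    by have [gen _] := sinv; apply: gen; rewrite !mem_cat mem_head orbT.
  right; apply: done_ensures; split=> [p [<-]|p pP pR]; first exact: goal_path_sound.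
  have fe : feasible by exists p.
  eexists; first by [].
  have [_ _ -> _ _] := generated_path F_inv F_complete gs.
  have [s' s'O fs'] := found _ _ _ pP pR sinv (oinv fe).
  have : ext_le (fval I a s) (Some (size p)).
    apply: ext_le_trans fs'; move: s'O; rewrite mem_cat inE orbCA -mem_cat.
    by case/predU1P=> [->|/(allP min_s)//]; apply: ext_le_refl.
  rewrite /fval /=; case: (mst_cost _ _) => //= m; apply: leq_trans; exact: leq_addr.
left; split; last exact: search_expand_measure.
split=> //; first exact: search_expand_inv.
case=> p pP pR; apply: optimal_expand_inv => //.
- exact: respects_start_safe pR.
- exact: feasible_goals_connected pP pR.
by apply: oinv; exists p.
Qed.

Lemma low_solver_ensures :
  ensures (low_step I cs a) low_result (low_init I cs a).
Proof.
pose Inv (l : low_state V) := if l is LBuild F then forest_inv I cs a F else False.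
pose mu (l : low_state V) := if l is LBuild F then forest_measure cs F else 0.
apply: (@ensures_measure _ _ _ Inv mu); last exact: forest_init_inv.
  move=> [F|F O C|r] l' // F_inv st; inversion st as [F1 F2 q T T' st'|F1 comp| | |]; subst.
    by left; split; [apply: forest_step_inv st' | apply: forest_step_measure st'].
  by right; apply: low_search_ensures.
move=> [F|F O C|r] // F_inv fin; exfalso.
have [comp|/allPn[[q T] qT nT]] := boolP (forest_complete F).
  by apply: fin (low_start _ _ _ comp).
have [T' st] := tree_progress I cs a nT.
case/splitPr: qT fin => F1 F2 fin; exact: fin (low_build F1 F2 q st).
Qed.

End LowSolver.

(** * The constraint tree *)

HB.instance Definition _ (V : finType) (k : nat) := gen_eqMixin (ct_node V k).

Section Constraints.
Variables (V : finType) (k : nat) (I : instance V k).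
Implicit Types (P : 'I_k -> seq V) (c : constraint V k) (cs : seq (constraint V k)).

Definition hit c (p : seq V) : Prop :=
  match c with
  | inl (a, t, v) => position I a p t = v
  | inr (a, t, u, v) => position I a p t = u /\ position I a p t.+1 = v
  end.

(** Edge constraints on waits would defeat the dominance of earlier arrivals; edge conflicts never
    create them. *)
Definition proper c : Prop := if c is inr (_, _, u, v) then u != v else True.

Lemma respects_nil a p : respects I [::] a p.
Proof. by move=> t. Qed.

Lemma respects_cons cs c a p :
  respects I (c :: cs) a p <->
  respects I cs a p /\ (constraint_agent c = a -> ~ hit c p).
Proof.
have E t : (safe (c :: cs) a (position I a p t) t &&
    move_allowed (c :: cs) a (position I a p t) (position I a p t.+1) t) =
  [&& inl (a, t, position I a p t) != c,
      inr (a, t, position I a p t, position I a p t.+1) != c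
    & safe cs a (position I a p t) t &&
      move_allowed cs a (position I a p t) (position I a p t.+1) t].
  by rewrite /safe /move_allowed !inE !negb_or -!andbA; congr andb; rewrite andbCA.
split=> [rc|[rc nh] t].
  split=> [t|]; first by have:= rc t; rewrite E => /and3P[].
  move=> ca hc; case: c ca hc rc E => [[[b t] v]|[[[b t] u] v]] /= -> => [<-|[<- <-]] rc E;
    by have := rc t; rewrite E eqxx ?andbF.
rewrite E rc andbT; apply/andP; split; apply/eqP=> Ec; case: nh; rewrite -Ec //=.
Qed.

Lemma hit_fresh cs c p : respects I cs (constraint_agent c) p -> hit c p -> c \notin cs.
Proof.
move=> rc; case: c rc => [[[b t] v]|[[[b t] u] v]] /= rc.
  by move=> <-; have /andP[] := rc t.
by case=> <- <-; have /andP[] := rc t.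
Qed.

Lemma collision_hit P t c1 c2 :
  collision I P t c1 c2 ->
  [/\ hit c1 (P (constraint_agent c1)), hit c2 (P (constraint_agent c2)),
      proper c1 /\ proper c2 & constraint_time c1 = t /\ constraint_time c2 = t].
Proof.
case=> [i j {}t v ij vi vj|i j {}t u v u' v' ij uv ui vi uj vj E]; split=> //.
(* If the second move were a wait, the common edge would be a single vertex and the first move a
   wait as well. *)
split=> //=; apply: contraTneq uv => u'v'; move: E; rewrite u'v' setUid => E.
have: u \in [set v'] by rewrite -E !inE eqxx.
have: v \in [set v'] by rewrite -E !inE eqxx orbT.
by rewrite !inE negbK => /eqP-> /eqP->.
Qed.

(** The two constraints record all positions involved. Applied to a solution as [P'], this shows
    that it violates at most one of them. *)
Lemma collision_transfer P P' t c1 c2 :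
  collision I P t c1 c2 -> hit c1 (P' (constraint_agent c1)) ->
  hit c2 (P' (constraint_agent c2)) -> collision I P' t c1 c2.
Proof.
case=> [i j {}t v ij _ _|i j {}t u v u' v' ij uv _ _ _ _ E] /=.
  by move=> h1 h2; apply: vertex_conflict.
by case=> ? ? [? ?]; apply: edge_conflict.
Qed.

Lemma first_collision P :
  ~ collision_free I P -> exists t c1 c2, collision I P t c1 c2 /\
    forall t' c1' c2', collision I P t' c1' c2' -> t <= t'.
Proof.
move=> ncf; have [t ct] : exists t, exists c1 c2, collision I P t c1 c2.
  by apply: contrapT => nex; apply: ncf => t c1 c2 col; apply: nex; exists t, c1, c2.
elim/ltn_ind: t ct => t IH [c1 [c2 col]].
have [[t' [lt_t ct']]|nex] := EM (exists t', t' < t /\ exists c1 c2, collision I P t' c1 c2).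
  exact: IH ct'.
exists t, c1, c2; split=> // t' c1' c2' col'; rewrite leqNgt; apply/negP=> lt_t.
by apply: nex; exists t'; split=> //; exists c1', c2'.
Qed.

(** After all agents have stopped nothing changes, so no collision is new. *)
Lemma first_collision_le P m t c1 c2 :
  (forall a, size (P a) <= m) -> collision I P t c1 c2 ->
  (forall t' c1' c2', collision I P t' c1' c2' -> t <= t') -> t <= m.
Proof.
move=> sz col first; rewrite leqNgt; apply/negP=> lt_t.
have pos a t' : m <= t' -> position I a (P a) t' = position I a (P a) m.
  by move=> le_t; rewrite !position_size ?(leq_trans (sz a)).
case: col first lt_t => [i j {}t v ij vi vj|i j {}t u v u' v' ij uv ui vi uj vj E] first lt_t.
  have col : collision I P m (inl (i, m, v)) (inl (j, m, v)).
    by apply: vertex_conflict; rewrite // -(pos _ t (ltnW lt_t)).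
  by have := first _ _ _ col; rewrite leqNgt lt_t.
case/eqP: uv; rewrite -ui -vi !pos //; [exact/leqW/ltnW | exact: ltnW].
Qed.

(** Presents the constraints with times below [m] as the image of a finite type, in order to count
    them. *)
Definition constraint_of (m : nat)
    (x : ('I_k * 'I_m * V) + ('I_k * 'I_m * V * V)) : constraint V k :=
  match x with
  | inl (a, t, v) => inl (a, t : nat, v)
  | inr (a, t, u, v) => inr (a, t : nat, u, v)
  end.

Definition max_constraints (m : nat) : nat :=
  #|{: ('I_k * 'I_m * V) + ('I_k * 'I_m * V * V)}|.

Lemma size_constraints m cs :
  uniq cs -> {in cs, forall c, constraint_time c < m} ->
  size cs <= max_constraints m.
Proof.
move=> ucs tcs; rewrite /max_constraints -(size_codom (@constraint_of m)).
apply: uniq_leq_size => // c /tcs; case: c => [[[a t] v]|[[[a t] u] v]] /= lt_t.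
  exact: (codom_f (@constraint_of m) (inl (a, Ordinal lt_t, v))).
exact: (codom_f (@constraint_of m) (inr (a, Ordinal lt_t, u, v))).
Qed.

End Constraints.

(** * The constraint tree compared with a fixed solution *)

Section Solvable.
Variables (V : finType) (k : nat) (I : instance V k).
Variable Ps : 'I_k -> seq V.
Hypothesis Ps_sol : is_solution I Ps.

Definition compatible (cs : seq (constraint V k)) : Prop :=
  forall a, respects I cs a (Ps a).

(** The length bound is conditional, since low-level optimality compares with the path of [Ps] only
    if that path obeys the constraints. *)
Record ct_inv (N : ct_node V k) : Prop := CTInv {
  ct_proper : {in ct_constraints N, forall c, proper c};
  ct_uniq : uniq (ct_constraints N);
  ct_time : {in ct_constraints N, forall c, constraint_time c < (soc Ps).+1};
  ct_path : forall a, is_agent_path I a (ct_paths N a);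
  ct_respects : forall a, respects I (ct_constraints N) a (ct_paths N a);
  ct_short : compatible (ct_constraints N) ->
    forall a, size (ct_paths N a) <= size (Ps a)
}.

Definition open_inv (open : seq (ct_node V k)) : Prop :=
  {in open, forall N, ct_inv N}.

Definition has_compatible (open : seq (ct_node V k)) : Prop :=
  exists2 N, N \in open & compatible (ct_constraints N).

Let K := max_constraints V k (soc Ps).+1.

(** Base three: a node is replaced by at most two children, each with one constraint more and hence
    a third of its weight. *)
Definition ct_measure (open : seq (ct_node V k)) : nat :=
  \sum_(N <- open) 3 ^ (K - size (ct_constraints N)).

Definition solved (st : mgcbs_state V k) : Prop :=
  exists P, st = MReturned (Some P) /\ is_solution I P.

Lemma proper_no_wait (cs : seq (constraint V k)) a :
  {in cs, forall c, proper c} -> forall v t, move_allowed cs a v v t.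
Proof. by move=> csP v t; apply/negP=> /csP; rewrite /= eqxx. Qed.

Lemma child_inv N c p :
  ct_inv N -> proper c -> constraint_time c < (soc Ps).+1 ->
  hit I c (ct_paths N (constraint_agent c)) ->
  low_spec I (c :: ct_constraints N) (constraint_agent c) (Some p) ->
  ct_inv (CTNode (c :: ct_constraints N)
    (set_path (ct_paths N) (constraint_agent c) p)).
Proof.
move=> [prop ucs tcs pathN respN shortN] pc tc hc [sound short].
have [p_path p_resp] := sound p erefl.
split=> /=.
- by move=> c'; rewrite inE => /predU1P[->|/prop].
- by rewrite ucs andbT; apply: hit_fresh hc.
- by move=> c'; rewrite inE => /predU1P[->|/tcs].
- by move=> a; rewrite /set_path; case: eqP => [->|].
- move=> a; rewrite /set_path; case: eqP => [->//|a_c].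
  by apply/respects_cons; split=> // /esym.
move=> comp a; rewrite /set_path; case: eqP => [->|_].
  by have [p' [<-]] := short _ (Ps_sol.1 _) (comp (constraint_agent c)).
by apply: shortN => b; have /respects_cons[] := comp b.
Qed.

Section Expand.
Variable bound : nat.
Hypothesis select_ensures : forall open,
  open_inv open -> has_compatible open -> ct_measure open < bound ->
  ensures (mgcbs_step I) solved (MSelect open).

(** [select_ensures] here is the induction hypothesis of the lemma of that name below. The
    disjunction says that a compatible node is open already or will be created by a pending
    constraint; the measure charges each pending constraint with the weight of its child. *)
Lemma expand_ensures todo open N :
  ct_inv N -> open_inv open ->
  {in todo, forall c, [/\ proper c, constraint_time c < (soc Ps).+1
    & hit I c (ct_paths N (constraint_agent c))]} ->
  has_compatible open \/ compatible (ct_constraints N) /\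
    (exists2 c, c \in todo & ~ hit I c (Ps (constraint_agent c))) ->
  ct_measure open + size todo * 3 ^ (K - (size (ct_constraints N)).+1) < bound ->
  ensures (mgcbs_step I) solved (MExpand open N todo).
Proof.
move=> invN; elim: todo open => [|c todo IH] open inv_o todoP comp lt_b.
  constructor=> [st' st|fin]; last by case: (fin _ (expand_done I open N)).
  inversion st; subst; apply: select_ensures => //; last by rewrite addn0 in lt_b.
  by case: comp => [//|[_ []]].
have [pc tc hc] := todoP c (mem_head _ _).
have todoP' : {in todo, forall c, [/\ proper c, constraint_time c < (soc Ps).+1
    & hit I c (ct_paths N (constraint_agent c))]}.
  by move=> c' c'P; apply: todoP; rewrite inE c'P orbT.
have proper' : {in c :: ct_constraints N, forall c, proper c}.
  by move=> c'; rewrite inE => /predU1P[->//|]; apply: ct_proper.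
have low := low_solver_ensures I (proper_no_wait (constraint_agent c) proper').
constructor=> [st' st|fin]; last by case: (fin _ (expand_call I open N c todo)).
inversion st; subst.
(* Induction on the inner run, whose steps are those of the enclosing state. *)
elim: low => {}l _ IHl finl; constructor=> [st1 st1P|fin]; last first.
  have finl' : final (low_step I (c :: ct_constraints N) (constraint_agent c)) l.
    by move=> l' lP; apply: (fin (MExpandCall open N c todo l')); apply: expand_low.
  case: (finl finl') => [[p|] El _]; rewrite El in fin.
    by case: (fin _ (expand_path I open N c todo p)).
  by case: (fin _ (expand_no_path I open N c todo)).
have final_done r : final (low_step I (c :: ct_constraints N) (constraint_agent c)) (LDone r).
  by move=> l' lP; inversion lP.
inversion st1P; subst.
- exact: IHl.
- have [r [<-] spec] := finl (final_done _).
  have invN' := child_inv invN pc tc hc spec.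
  apply: IH => //.
  + by move=> N'; rewrite inE => /predU1P[->|/inv_o].
  + case: comp => [[N' N'P compN']|[compN [c' + nhit]]].
      by left; exists N'; rewrite // inE N'P orbT.
    rewrite inE => /predU1P[E|c'P]; last by right; split=> //; exists c'.
    left; eexists; first exact: mem_head.
    move=> a /=; apply/respects_cons; split; first exact: compN.
    by move=> <-; rewrite -E.
  rewrite /ct_measure big_cons /= addnAC addnC.
  by move: lt_b; rewrite /= mulSn addnCA addnC -addnA addnC.
have [r [<-] spec] := finl (final_done _).
apply: IH => //; last first.
  by apply: leq_ltn_trans lt_b; rewrite leq_add2l leq_mul2r leqnSn orbT.
case: comp => [|[compN [c' + nhit]]]; first by left.
rewrite inE => /predU1P[E|c'P]; last by right; split=> //; exists c'.
(* The low-level solver cannot fail here, because the path of [Ps] is feasible for the child. *)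
have [_ /(_ (Ps (constraint_agent c)))[||//]] := spec; first exact: Ps_sol.1.
by apply/respects_cons; split=> // _; rewrite -E.
Qed.

End Expand.

Lemma select_ensures open :
  open_inv open -> has_compatible open ->
  ensures (mgcbs_step I) solved (MSelect open).
Proof.
have [n] := ubnP (ct_measure open); elim: n open => [|n IH] open; first by rewrite ltn0.
rewrite ltnS => le_n inv_o [N0 N0o compN0].
have soc0 : soc (ct_paths N0) <= soc Ps.
  by apply: leq_sum => a _; apply: (ct_short (inv_o N0 N0o)).
constructor=> [st' st|fin]; last first.
  exfalso; have no : ~~ nilp open by apply: contraTN N0o => /nilP->.
  have [O1 [N [O2 [E min_N]]]] := ext_argmin (fun N => Some (soc (ct_paths N))) no.
  subst open; have [cf|ncf] := EM (collision_free I (ct_paths N)).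
    exact: (fin _ (select_return min_N cf)).
  have [t [c1 [c2 [col first]]]] := first_collision ncf.
  exact: (fin _ (select_branch min_N col first)).
inversion st as [| | | | |E|O1 O2 N min_N cf E|O1 O2 N t c1 c2 min_N col first E| | | | |];
  subst.
- by [].
- constructor=> [st'' st2|_]; first by inversion st2.
  exists (ct_paths N); split=> //; split=> // a.
  by apply: ct_path; apply: inv_o; rewrite mem_cat mem_head orbT.
have invN : ct_inv N by apply: inv_o; rewrite mem_cat mem_head orbT.
have [h1 h2 [p1 p2] [t1 t2]] := collision_hit col.
(* The selected node costs at most as much as the compatible node [N0], hence at most [soc Ps],
   which therefore bounds each of its paths. *)
have le_t : t <= soc Ps.
  apply: (first_collision_le _ col first) => a.
  apply: (@leq_trans (soc (ct_paths N))).
    by rewrite /soc (bigD1 a) //= leq_addr.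
  apply: leq_trans soc0; move: N0o; rewrite mem_cat inE orbCA -mem_cat.
  by case/predU1P=> [->//|/(allP min_N)].
have inv' : open_inv (O1 ++ O2).
  by move=> N' N'P; apply: inv_o; move: N'P; rewrite !mem_cat inE => /orP[]->; rewrite ?orbT.
(* Strict because the new constraint [c1] is counted too; the exponent in the weight of [N] is thus
   positive. *)
have inv1 : size (ct_constraints N) < K.
  rewrite -[X in X <= _]/(size (c1 :: ct_constraints N)); apply: size_constraints.
    by rewrite /= (ct_uniq invN) andbT; apply: hit_fresh h1; apply: ct_respects.
  by move=> c; rewrite inE => /predU1P[->|/(ct_time invN)//]; rewrite t1.
apply: (expand_ensures (bound := n) _ invN inv').
- by move=> O' ? ? ?; apply: IH.
- by move=> c; rewrite !inE => /orP[]/eqP->; split; rewrite ?t1 ?t2.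
- move: N0o; rewrite mem_cat inE orbCA -mem_cat => /predU1P[E0|N0P]; last by left; exists N0.
  (* If [Ps] hit both constraints, it would contain this very collision. *)
  right; subst N0; split=> //; apply: contrapT => nex.
  apply: (Ps_sol.2 t c1 c2); apply: collision_transfer col _ _; apply: contrapT => nh;
    apply: nex; [exists c1 | exists c2]; by rewrite ?inE ?eqxx ?orbT.
apply: leq_trans le_n; rewrite /ct_measure !big_cat big_cons /= addnCA addnC.
rewrite ltn_add2r; have -> : K - size (ct_constraints N) =
    (K - (size (ct_constraints N)).+1).+1 by rewrite subnS prednK // subn_gt0.
by rewrite expnS ltn_pmul2r ?expn_gt0.
Qed.

Lemma root_ensures P todo :
  (forall a, a \notin todo -> is_agent_path I a (P a) /\ size (P a) <= size (Ps a)) ->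
  ensures (mgcbs_step I) solved (MRoot P todo).
Proof.
elim: todo P => [|a todo IH] P PP.
  constructor=> [st' st|fin]; last by case: (fin _ (root_done I P)).
  inversion st; subst; apply: select_ensures.
    by move=> N; rewrite mem_seq1 => /eqP->; split=> //= [a|_ a]; case: (PP a).
  by exists (CTNode [::] P); rewrite ?mem_head // => a; apply: respects_nil.
constructor=> [st' st|fin]; last by case: (fin _ (root_call I P a todo)).
inversion st; subst.
have no_constraint : {in [::], forall c : constraint V k, proper c} by [].
have low := low_solver_ensures I (proper_no_wait a no_constraint).
elim: low => {}l _ IHl finl; constructor=> [st1 st1P|fin]; last first.
  have finl' : final (low_step I [::] a) l.
    by move=> l' lP; apply: (fin (MRootCall P a todo l')); apply: root_low.
  case: (finl finl') => [[p|] El _]; rewrite El in fin.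
    by case: (fin _ (root_path I P a todo p)).
  by case: (fin _ (root_no_path I P a todo)).
have final_done r : final (low_step I [::] a) (LDone r).
  by move=> l' lP; inversion lP.
have spec_short r : low_spec I [::] a r ->
    exists2 p, r = Some p & size p <= size (Ps a).
  by case=> _; apply; [apply: Ps_sol.1 | apply: respects_nil].
inversion st1P; subst.
- exact: IHl.
- have [r [<-] spec] := finl (final_done _); have [p' [<-] le_p] := spec_short _ spec.
  apply: IH => b b_todo; rewrite /set_path; case: eqP => [->|/eqP b_a].
    by split=> //; case: (spec.1 p erefl).
  by apply: PP; rewrite inE negb_or b_a.
have [r [<-] /spec_short[//]] := finl (final_done _).
Qed.

End Solvable.

Theorem theorem3 (V : finType) (k : nat) (I : instance V k) :
  (exists P : 'I_k -> seq V, is_solution I P) ->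
  terminates (mgcbs_step I) (mgcbs_init V k) /\
  (forall st : mgcbs_state V k,
     reachable (mgcbs_step I) (mgcbs_init V k) st ->
     final (mgcbs_step I) st ->
     exists P : 'I_k -> seq V, st = MReturned (Some P) /\ is_solution I P).
Proof.
case=> Ps Ps_sol; have root : ensures (mgcbs_step I) (solved I) (mgcbs_init V k).
  by apply: (root_ensures Ps_sol) => a; rewrite mem_enum.
split; first exact: ensures_terminates root.
by move=> st /(ensures_reachable root); apply: ensures_final.
Qed.
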